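(* There exists a non-deterministic $\mathrm{CMSO}[2]$-transduction $\tau$ such that for any connected directed graph $G$ represented as the $\{\mathsf{edge}\}$-structure $\mathbb{G}$, $\tau(\mathbb{G})$ is non-empty and every output in $\tau(\mathbb{G})$ is equal to some $\{\mathsf{t\text{-}edge},\mathsf{c\text{-}edge}\}$-structure $\mathbb{H}$ representing the (enriched) canonical split decomposition of $G$.
   Context: Logic and transductions. Structures over an extended vocabulary consist of a finite universe together with interpretations of relation names (relations on the universe) and of set predicate names (relations on subsets of the universe). $\mathrm{CMSO}[2]$ is monadic second-order logic over such structures extended with a unary set predicate true of a set iff its size is even. A transduction is a set $\tau$ of (input, output) structure pairs; $\tau(\mathbb{A})$ is the set of outputs on input $\mathbb{A}$. A $\mathrm{CMSO}[2]$-transduction is a finite composition of atomic transductions: filtering (keep the input unchanged iff it satisfies a fixed sentence); universe restriction (restrict universe and all relations/predicates to the elements satisfying a fixed formula with one free first-order variable); interpretation (same universe, each output symbol $Q$ interpreted as the tuples satisfying a fixed formula with $\mathrm{ar}(Q)$ free variables, first-order for relation names, monadic for set predicate names); copying (for fixed $k$, add $k$ fresh copies of every element and binary relations $\mathsf{copy}_i$ relating each original element to its $i$-th copy); colouring (add a new unary relation interpreted as an arbitrary subset of the universe, every choice yielding an output). It is non-deterministic if it uses colouring. Splits. A directed graph $G$ is represented as the $\{\mathsf{edge}\}$-structure with universe $V(G)$ and $\mathsf{edge}=E(G)$. A split of $G$ is a bipartition $\{X,Y\}$ of $V(G)$ into non-empty sets for which there are $X^{\mathrm{in}},X^{\mathrm{out}}\subseteq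 X$ and $Y^{\mathrm{in}},Y^{\mathrm{out}}\subseteq Y$ such that for all $x\in X$, $y\in Y$: $xy\in E(G)$ iff $x\in X^{\mathrm{out}}$ and $y\in Y^{\mathrm{in}}$, and $yx\in E(G)$ iff $y\in Y^{\mathrm{out}}$ and $x\in X^{\mathrm{in}}$. Two bipartitions $\{X,Y\},\{X',Y'\}$ overlap if $X\cap X'$, $X\cap Y'$, $Y\cap X'$, $Y\cap Y'$ are all non-empty; a split is strong if it overlaps no split. Let $T$ be the unique unrooted tree with leaf set $V(G)$, inner nodes of degree $\ge3$, such that $e\mapsto\{L(T_1),L(T_2)\}$ ($T_1,T_2$ the components of $T-e$, $L$ = leaf set) is a bijection from $E(T)$ onto the strong splits. For a node $t$ and neighbour $s$, $T^t_s$ is the component of $T-t$ containing $s$. Enriched split decomposition. For every edge $uv$ of $T$ introduce two marker vertices $\vec{uv}$ and $\vec{vu}$. For every inner node $u$ of $T$ let $G_u$ be the directed graph on $\{\vec{uv}: v \text{ neighbour of } u\}$ with an arc from $\vec{uv}$ to $\vec{uw}$ iff there are $x\in L(T^u_v)$, $y\in L(T^u_w)$ with $xy\in E(G)$. The enriched (canonical) split decomposition of $G$ is $(H,F)$ where $H$ is the directed graph on the set of all marker vertices whose arcs ($\mathsf{c}$-edges) are the arcs of the graphs $G_u$, $u$ inner, and $F$ ($\mathsf{t}$-edges) is the symmetric relation containing $\vec{uv}\vec{vu}$ and $\vec{vu}\vec{uv}$ for every edge $uv$ of $T$. It is represented by the $\{\mathsf{t\text{-}edge},\mathsf{c\text{-}edge}\}$-structure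 with universe the marker vertices, $\mathsf{c\text{-}edge}$ the arcs of $H$ and $\mathsf{t\text{-}edge}=F$. *)

(* Defs.v *)
From mathcomp Require Import all_boot.
Set Implicit Arguments.
Unset Strict Implicit.
Unset Printing Implicit Defensive.

Record voc := Voc {
  rname : Type; rar : rname -> nat;
  sname : Type; sar : sname -> nat }.

Arguments rar : clear implicits.
Arguments sar : clear implicits.

Record struct (s : voc) := Struct {
  univ : finType;
  rint : forall r : rname s, pred ((rar s r).-tuple univ);
  sint : forall p : sname s, pred ((sar s p).-tuple {set univ}) }.
Arguments Struct {s}.
Arguments univ {s}.
Arguments rint {s} s0 r : rename.
Arguments sint {s} s0 p : rename.

Definition iso s (A B : struct s) : Prop :=
  exists f : univ A -> univ B,
    [/\ bijective f,
        forall r t, rint A r t = rint B r (map_tuple f t) &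
        forall p Ts, sint A p Ts = sint B p (map_tuple (fun X : {set univ A} => f @: X) Ts)].

(* CMSO[2] formulas (de Bruijn style, indexed by the numbers of        *)
(* first-order / monadic second-order variables in scope).            *)

Inductive form (s : voc) : nat -> nat -> Type :=
| FFalse n m : form s n m
| FRel n m (r : rname s) (xs : (rar _ r).-tuple 'I_n) : form s n m
| FSet n m (p : sname s) (Xs : (sar _ p).-tuple 'I_m) : form s n m
| FEq n m (x y : 'I_n) : form s n m
| FMem n m (x : 'I_n) (X : 'I_m) : form s n m
| FEven n m (X : 'I_m) : form s n m
| FNot n m : form s n m -> form s n m
| FAnd n m : form s n m -> form s n m -> form s n m
| FEx1 n m : form s n.+1 m -> form s n m       (* binds FO variable 0 *)
| FEx2 n m : form s n m.+1 -> form s n m.      (* binds set variable 0 *)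

Definition ext (T : Type) n (a : T) (v : 'I_n -> T) : 'I_n.+1 -> T :=
  fun i => match unlift ord0 i with Some j => v j | None => a end.

Definition nilval (T : Type) : 'I_0 -> T :=
  fun i => False_rect T (notF (ltn_ord i)).

Fixpoint sat s (A : struct s) n m (f : form s n m) :
    ('I_n -> univ A) -> ('I_m -> {set univ A}) -> bool :=
  match f in form _ n m return ('I_n -> univ A) -> ('I_m -> {set univ A}) -> bool with
  | FFalse _ _ => fun _ _ => false
  | FRel _ _ r xs => fun v _ => rint A r (map_tuple v xs)
  | FSet _ _ p Xs => fun _ V => sint A p (map_tuple V Xs)
  | FEq _ _ x y => fun v _ => v x == v y
  | FMem _ _ x X => fun v V => v x \in V X
  | FEven _ _ X => fun _ V => ~~ odd #|V X|
  | FNot _ _ g => fun v V => ~~ sat g v V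
  | FAnd _ _ g h => fun v V => sat g v V && sat h v V
  | FEx1 _ _ g => fun v V => [exists a, sat g (ext a v) V]
  | FEx2 _ _ g => fun v V => [exists X, sat g v (ext X V)]
  end.

Definition copy_voc (s : voc) (k : nat) : voc :=
  Voc (fun r : (rname s + 'I_k)%type =>
         match r with inl r => rar _ r | inr _ => 2 end)
      (sar s).

Definition colour_voc (s : voc) : voc :=
  Voc (fun r : (rname s + unit)%type =>
         match r with inl r => rar _ r | inr _ => 1 end)
      (sar s).

Inductive atomic : voc -> voc -> Type :=
| AFilter (s : voc) (phi : form s 0 0) : atomic s s
| ARestrict (s : voc) (phi : form s 1 0) : atomic s s
| AInterp (s s' : voc)
    (fr : forall r : rname s', form s (rar _ r) 0)
    (fs : forall p : sname s', form s 0 (sar _ p)) : atomic s s'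
| ACopy (s : voc) (k : nat) : atomic s (copy_voc s k)
| AColour (s : voc) : atomic s (colour_voc s).

Definition restrict_struct s (A : struct s) (P : pred (univ A)) : struct s :=
  Struct {x : univ A | P x}
    (fun r t => rint A r (map_tuple val t))
    (fun p Ts => sint A p (map_tuple (fun X : {set {x : univ A | P x}} => val @: X) Ts)).

Definition interp_struct s s' (A : struct s)
    (fr : forall r : rname s', form s (rar _ r) 0)
    (fs : forall p : sname s', form s 0 (sar _ p)) : struct s' :=
  Struct (univ A)
    (fun r t => @sat s A _ 0 (fr r) (tnth t) (nilval _))
    (fun p Ts => @sat s A 0 _ (fs p) (nilval _) (tnth Ts)).

(* copying: element (x, 0) is the original x, (x, i.+1) its (i+1)-th copy *)
Definition copy_struct s (A : struct s) (k : nat) : struct (copy_voc s k) :=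
  Struct ((univ A * 'I_k.+1)%type)
    (fun r => match r as r0 return
                pred ((rar (copy_voc s k) r0).-tuple (univ A * 'I_k.+1)) with
              | inl r => fun t => all (fun x => x.2 == ord0) t
                                  && rint A r (map_tuple fst t)
              | inr i => fun t =>
                  [&& (tnth t ord0).2 == ord0,
                      (tnth t ord_max).1 == (tnth t ord0).1 &
                      (tnth t ord_max).2 == lift ord0 i]
              end)
    (fun p Ts => [forall j, tnth Ts j \subset [set x | x.2 == ord0]]
                 && sint A p (map_tuple (fun X : {set (univ A * 'I_k.+1)%type} => [set x.1 | x in X]) Ts)).

Definition colour_struct s (A : struct s) (C : {set univ A}) : struct (colour_voc s) :=
  Struct (univ A)
    (fun r => match r as r0 return
                pred ((rar (colour_voc s) r0).-tuple (univ A)) with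
              | inl r => rint A r
              | inr _ => fun t => tnth t ord0 \in C
              end)
    (@sint s A).

Definition atomic_sem s s' (a : atomic s s') : struct s -> struct s' -> Prop :=
  match a in atomic s s' return struct s -> struct s' -> Prop with
  | AFilter s phi => fun A B => B = A /\ @sat s A 0 0 phi (nilval _) (nilval _)
  | ARestrict s phi => fun A B =>
      B = @restrict_struct s A (fun x => @sat s A 1 0 phi (fun _ => x) (nilval _))
  | AInterp s s' fr fs => fun A B => B = @interp_struct s s' A fr fs
  | ACopy s k => fun A B => B = @copy_struct s A k
  | AColour s => fun A B => exists C : {set univ A}, B = @colour_struct s A C
  end.

Inductive trans : voc -> voc -> Type :=
| TNil (s : voc) : trans s s
| TCons (s1 s2 s3 : voc) : atomic s1 s2 -> trans s2 s3 -> trans s1 s3.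

Fixpoint tsem s s' (t : trans s s') : struct s -> struct s' -> Prop :=
  match t in trans s s' return struct s -> struct s' -> Prop with
  | TNil _ => fun A B => B = A
  | TCons _ _ _ a t' => fun A B => exists C, atomic_sem a A C /\ tsem t' C B
  end.

Definition graph_voc : voc := Voc (fun _ : unit => 2) (fun e : Empty_set => match e with end).

Inductive dsym := TEdge | CEdge.
Definition decomp_voc : voc := Voc (fun _ : dsym => 2) (fun e : Empty_set => match e with end).

Definition graph_struct (V : finType) (E : rel V) : struct graph_voc :=
  Struct (s := graph_voc) V (fun _ t => E (tnth t ord0) (tnth t ord_max))
         (fun p => match p with end).

Definition gconnected (V : finType) (E : rel V) : Prop :=
  forall x y, connect (fun a b => E a b || E b a) x y.

Section Splits.
Variables (V : finType) (E : rel V).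

Definition is_split (X Y : {set V}) : Prop :=
  [/\ X :&: Y = set0, X :|: Y = setT, X != set0, Y != set0 &
    exists Xin Xout Yin Yout : {set V},
      [/\ Xin \subset X, Xout \subset X, Yin \subset Y, Yout \subset Y &
        forall x y, x \in X -> y \in Y ->
          E x y = (x \in Xout) && (y \in Yin) /\
          E y x = (y \in Yout) && (x \in Xin)]].

Definition overlap (X Y X' Y' : {set V}) : Prop :=
  [/\ X :&: X' != set0, X :&: Y' != set0, Y :&: X' != set0 & Y :&: Y' != set0].

Definition strong_split (X Y : {set V}) : Prop :=
  is_split X Y /\ forall X' Y', is_split X' Y' -> ~ overlap X Y X' Y'.

Definition upair_eq (T : eqType) (X Y X' Y' : T) : bool :=
  (X == X') && (Y == Y') || (X == Y') && (Y == X').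

Variables (N : finType) (adj : rel N) (leaf : V -> N).

Definition deg (z : N) : nat := #|[set y | adj z y]|.

Definition is_tree : Prop :=
  [/\ symmetric adj, irreflexive adj,
      (forall x y, connect adj x y) &
      ~ (exists c : seq N, [/\ 3 <= size c, uniq c & cycle adj c])].

Definition comp_node (u v : N) : {set N} :=
  [set z | connect (fun a b => [&& adj a b, a != u & b != u]) v z].

Definition comp_edge (u v w : N) : {set N} :=
  [set z | connect (fun a b => adj a b &&
             ~~ ((a == u) && (b == v) || (a == v) && (b == u))) w z].

Definition leaves_of (S : {set N}) : {set V} := [set x | leaf x \in S].

Definition edge_split1 (u v : N) := leaves_of (comp_edge u v u).
Definition edge_split2 (u v : N) := leaves_of (comp_edge u v v).

Definition split_tree : Prop :=
  [/\ is_tree, injective leaf,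
      (forall z, (deg z <= 1) = (z \in codom leaf)) &
      (forall z, z \notin codom leaf -> 3 <= deg z)] /\
  [/\
      (forall u v, adj u v -> strong_split (edge_split1 u v) (edge_split2 u v)),
      (forall u v u' v', adj u v -> adj u' v' ->
         upair_eq (edge_split1 u v) (edge_split2 u v)
                  (edge_split1 u' v') (edge_split2 u' v') ->
         upair_eq u v u' v') &
      (forall X Y, strong_split X Y ->
         exists u v, adj u v /\
           upair_eq X Y (edge_split1 u v) (edge_split2 u v))].

Definition marker : finType := {p : N * N | adj p.1 p.2}.

Definition Lnode (u v : N) : {set V} := leaves_of (comp_node u v).

Definition enriched : struct decomp_voc :=
  Struct (s := decomp_voc) marker
    (fun d t =>
       let a := val (tnth t ord0) in
       let b := val (tnth t ord_max) in
       match d with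
       | TEdge => (b.1 == a.2) && (b.2 == a.1)
       | CEdge => [&& a.1 == b.1, a.1 \notin codom leaf, a.2 != b.2 &
                    [exists x in Lnode a.1 a.2, exists y in Lnode a.1 b.2, E x y]]
       end)
    (fun p => match p with end).

End Splits.

(* Main.v *)
Require Import Defs.
From mathcomp Require Import all_boot.
From Stdlib Require Import FunctionalExtensionality.

(* Orient every strong split in both ways: the marker vertex on the edge uv at
   u corresponds to the strong set L(T^u_v), a t-edge joins a strong set to its
   complement, and two markers lie in the same G_u iff their strong sets S, S'
   are disjoint, do not cover V, and no strong set other than S and ~S' lies
   between S and ~S'.  This describes the enriched decomposition by MSO formulas
   with set variables, whatever the tree, so it remains to name strong sets by
   vertices.

   Fix a root vertex r.  The strong sets avoiding r form a laminar family F
   containing the singletons, and they are the nodes of the tree other than r.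
   A singleton is named by its element.  Every larger X in F picks one of three
   classes i and two leaves of class i below distinct children of X, one of
   them marked, so that the paths joining such pairs of leaves in the tree share
   no edge within a class, and no path of class i leaves X upwards.  An edge,
   seen as a set Y in F, is then used by class i iff Y contains an odd number of
   leaves of class i, so X is the least even set above its marked leaf.  Three
   classes suffice because at most two paths enter X from above: X picks a class
   other than theirs and sends them to different children. *)

Set Implicit Arguments.
Unset Strict Implicit.
Unset Printing Implicit Defensive.

(** * Definable predicates and set parameters *)

Lemma ext0 (T : Type) n (a : T) (v : 'I_n -> T) : ext a v ord0 = a.
Proof. by rewrite /ext unlift_none. Qed.

Lemma ext_lift (T : Type) n (a : T) (v : 'I_n -> T) i :
  ext a v (lift ord0 i) = v i.
Proof. by rewrite /ext liftK. Qed.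

Lemma ext_liftE (T : Type) n (a : T) (v : 'I_n -> T) :
  (fun i => ext a v (lift ord0 i)) = v.
Proof. by apply: functional_extensionality => i; rewrite ext_lift. Qed.

Lemma ext_split (T : Type) n (w : 'I_n.+1 -> T) :
  ext (w ord0) (fun i => w (lift ord0 i)) = w.
Proof.
apply: functional_extensionality => i; rewrite /ext.
by case: unliftP => [j|] ->.
Qed.

Lemma eq_fun_ord0 (T : Type) (v w : 'I_0 -> T) : v = w.
Proof. by apply: functional_extensionality => -[]. Qed.

Definition FOr s n m (f g : form s n m) := FNot (FAnd (FNot f) (FNot g)).

Definition FAll1 s n m (f : form s n.+1 m) := FNot (FEx1 (FNot f)).

Definition FAny s n m (K : finType) (f : K -> form s n m) :=
  foldr (fun c => FOr (f c)) (FFalse s n m) (enum K).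

Section Sat.
Variables (s : voc) (A : struct s) (n m : nat).
Implicit Types (v : 'I_n -> univ A) (W : 'I_m -> {set univ A}).

Lemma sat_or (f g : form s n m) v W :
  sat (FOr f g) v W = sat f v W || sat g v W.
Proof. by rewrite /= negb_and !negbK. Qed.

Lemma sat_all1 (f : form s n.+1 m) v W :
  sat (FAll1 f) v W = [forall a, sat f (ext a v) W].
Proof. by rewrite /= negb_exists; apply: eq_forallb => a; rewrite negbK. Qed.

Lemma sat_any (K : finType) (f : K -> form s n m) v W :
  sat (FAny f) v W = [exists c, sat (f c) v W].
Proof.
rewrite /FAny; have -> : sat (foldr (fun c => FOr (f c)) (FFalse s n m) (enum K)) v W
    = has (fun c => sat (f c) v W) (enum K).
  elim: (enum K) => [//|c l IH]; rewrite [RHS]/= -IH; exact: sat_or.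
apply/hasP/existsP => [[c _ h]|[c h]]; exists c => //.
by rewrite mem_enum.
Qed.

End Sat.

Section Definable.
Variables n m : nat.

(* [definable P] is informative, so that families of definable predicates
   directly give families of formulas. *)
Definition gpred a b :=
  forall V : finType, rel V -> ('I_a -> V) -> ('I_b -> {set V}) -> bool.

Definition definable a b (P : gpred a b) : Type :=
  {f : form graph_voc a b | forall (V : finType) (E : rel V) v W,
     @sat graph_voc (graph_struct E) a b f v W = P V E v W}.

Implicit Types P Q : gpred n m.

Lemma def_ext P Q : (forall V E v W, P V E v W = Q V E v W) ->
  definable P -> definable Q.
Proof. by move=> h [f hf]; exists f => V E v W; rewrite hf h. Qed.

Lemma def_false : @definable n m (fun V E v W => false).
Proof. by exists (FFalse _ n m). Qed.

Lemma def_edge i j : @definable n m (fun V E v W => E (v i) (v j)).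
Proof. by exists (@FRel graph_voc n m tt [tuple i; j]) => V E v W. Qed.

Lemma def_eqv i j : @definable n m (fun V E v W => v i == v j).
Proof. by exists (FEq _ m i j) => V E v W. Qed.

Lemma def_mem i j : @definable n m (fun V E v W => v i \in W j).
Proof. by exists (FMem _ i j) => V E v W. Qed.

Lemma def_odd j : @definable n m (fun V E v W => odd #|W j|).
Proof. by exists (FNot (FEven _ n j)) => V E v W /=; rewrite negbK. Qed.

Lemma def_not P : definable P -> definable (fun V E v W => ~~ P V E v W).
Proof. by move=> [f hf]; exists (FNot f) => V E v W /=; rewrite hf. Qed.

Lemma def_and P Q : definable P -> definable Q ->
  definable (fun V E v W => P V E v W && Q V E v W).
Proof. by move=> [f hf] [g hg]; exists (FAnd f g) => V E v W /=; rewrite hf hg. Qed.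

Lemma def_or P Q : definable P -> definable Q ->
  definable (fun V E v W => P V E v W || Q V E v W).
Proof. by move=> [f hf] [g hg]; exists (FOr f g) => V E v W; rewrite sat_or hf hg. Qed.

Lemma def_imp P Q : definable P -> definable Q ->
  definable (fun V E v W => P V E v W ==> Q V E v W).
Proof.
move=> [f hf] [g hg]; exists (FOr (FNot f) g) => V E v W.
by rewrite sat_or /= hf hg implybE.
Qed.

Lemma def_iff P Q : definable P -> definable Q ->
  definable (fun V E v W => P V E v W == Q V E v W).
Proof.
move=> dP dQ; apply: (@def_ext
  (fun V E v W => (P V E v W ==> Q V E v W) && (Q V E v W ==> P V E v W))).
  by move=> V E v W; case: (P V E v W); case: (Q V E v W).
by apply: def_and; apply: def_imp.
Qed.

Lemma def_ex1 (Q : forall V : finType, rel V -> ('I_n -> V) -> ('I_m -> {set V}) ->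
    V -> bool) :
  @definable n.+1 m (fun V E v W =>
    Q V E (fun i => v (lift ord0 i)) W (v ord0)) ->
  definable (fun V E v W => [exists a, Q V E v W a]).
Proof.
move=> [f hf]; exists (FEx1 f) => V E v W /=; apply: eq_existsb => a.
by rewrite hf ext0 ext_liftE.
Qed.

Lemma def_ex2 (Q : forall V : finType, rel V -> ('I_n -> V) -> ('I_m -> {set V}) ->
    {set V} -> bool) :
  @definable n m.+1 (fun V E v W =>
    Q V E v (fun i => W (lift ord0 i)) (W ord0)) ->
  definable (fun V E v W => [exists X, Q V E v W X]).
Proof.
move=> [f hf]; exists (FEx2 f) => V E v W /=; apply: eq_existsb => a.
by rewrite hf ext0 ext_liftE.
Qed.

Lemma def_exK (K : finType) (Q : K -> gpred n m) :
  (forall c, definable (Q c)) -> definable (fun V E v W => [exists c, Q c V E v W]).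
Proof.
move=> dQ; exists (FAny (fun c => sval (dQ c))) => V E v W; rewrite sat_any.
by apply: eq_existsb => c; rewrite (svalP (dQ c)).
Qed.

End Definable.

Lemma def_all1 n m (Q : forall V : finType, rel V -> ('I_n -> V) -> ('I_m -> {set V}) ->
    V -> bool) :
  @definable n.+1 m (fun V E v W =>
    Q V E (fun i => v (lift ord0 i)) W (v ord0)) ->
  definable (fun V E v W => [forall a, Q V E v W a]).
Proof.
move=> dQ; apply: def_ext; last first.
  apply: def_not; apply: (def_ex1 (Q := fun V E v W a => ~~ Q V E v W a)).
  by apply: def_not; exact: dQ.
by move=> V E v W /=; rewrite negb_exists; apply: eq_forallb => a; rewrite negbK.
Qed.

Lemma def_all2 n m (Q : forall V : finType, rel V -> ('I_n -> V) -> ('I_m -> {set V}) ->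
    {set V} -> bool) :
  @definable n m.+1 (fun V E v W =>
    Q V E v (fun i => W (lift ord0 i)) (W ord0)) ->
  definable (fun V E v W => [forall X, Q V E v W X]).
Proof.
move=> dQ; apply: def_ext; last first.
  apply: def_not; apply: (def_ex2 (Q := fun V E v W a => ~~ Q V E v W a)).
  by apply: def_not; exact: dQ.
by move=> V E v W /=; rewrite negb_exists; apply: eq_forallb => a; rewrite negbK.
Qed.

Lemma def_allK n m (K : finType) (Q : K -> gpred n m) :
  (forall c, definable (Q c)) -> definable (fun V E v W => [forall c, Q c V E v W]).
Proof.
move=> dQ; apply: def_ext; last first.
  apply: def_not; apply: (def_exK (Q := fun c V E v W => ~~ Q c V E v W)) => c.
  exact: def_not.
by move=> V E v W /=; rewrite negb_exists; apply: eq_forallb => a; rewrite negbK.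
Qed.

Lemma def_subset n m i j : @definable n m (fun V E v W => W i \subset W j).
Proof.
apply: (@def_ext _ _ (fun V E v W => [forall a, (a \in W i) ==> (a \in W j)])).
  by move=> V E v W; apply/forallP/subsetP => [h x|h x]; [exact/implyP | apply/implyP/h].
by apply: def_all1; apply: def_imp; apply: def_mem.
Qed.

Lemma def_eqset n m i j : @definable n m (fun V E v W => W i == W j).
Proof.
apply: (@def_ext _ _ (fun V E v W => (W i \subset W j) && (W j \subset W i))).
  by move=> V E v W; rewrite eqEsubset.
by apply: def_and; apply: def_subset.
Qed.

Lemma def_eqsetC n m i j : @definable n m (fun V E v W => W i == ~: W j).
Proof.
apply: (@def_ext _ _ (fun V E v W => [forall a, (a \in W i) == ~~ (a \in W j)])).
  move=> V E v W; apply/forallP/eqP => [h|-> a]; last by rewrite inE.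
  by apply/setP => x; rewrite inE; apply/eqP.
by apply: def_all1; apply: def_iff; last apply: def_not; apply: def_mem.
Qed.

Lemma def_eqset1 n m i j : @definable n m (fun V E v W => W i == [set v j]).
Proof.
apply: (@def_ext _ _ (fun V E v W => [forall a, (a \in W i) == (a == v j)])).
  move=> V E v W; apply/forallP/eqP => [h|-> a]; last by rewrite inE.
  by apply/setP => x; rewrite inE; apply/eqP.
by apply: def_all1; apply: def_iff; [apply: def_mem | apply: def_eqv].
Qed.

Lemma def_oddI n m i j : @definable n m (fun V E v W => odd #|W i :&: W j|).
Proof.
apply: (@def_ext _ _ (fun V E v W =>
  [exists X : {set V}, [forall a, (a \in X) == (a \in W i) && (a \in W j)] && odd #|X|])).
  move=> V E v W; apply/existsP/idP => [[X /andP [/forallP h]]|h].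
    suff -> : X = W i :&: W j by [].
    by apply/setP => x; rewrite inE; apply/eqP.
  by exists (W i :&: W j); rewrite h andbT; apply/forallP => x; rewrite inE.
apply: def_ex2; apply: def_and; last exact: def_odd.
apply: def_all1; apply: def_iff; [|apply: def_and]; apply: def_mem.
Qed.

(** * Trading free set variables for colours *)

Fixpoint lift_form s n m (f : form s n m) : form (colour_voc s) n m :=
  match f in form _ n m return form (colour_voc s) n m with
  | FFalse n m => FFalse _ n m
  | FRel n m r xs => @FRel (colour_voc s) n m (inl r) xs
  | FSet n m p Xs => @FSet (colour_voc s) n m p Xs
  | FEq n m x y => FEq _ m x y
  | FMem n m x X => FMem _ x X
  | FEven n m X => FEven _ n X
  | FNot n m g => FNot (lift_form g)
  | FAnd n m g h => FAnd (lift_form g) (lift_form h)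
  | FEx1 n m g => FEx1 (lift_form g)
  | FEx2 n m g => FEx2 (lift_form g)
  end.

Lemma sat_lift s (A : struct s) C n m (f : form s n m)
    (v : 'I_n -> univ A) (W : 'I_m -> {set univ A}) :
  @sat _ (colour_struct C) n m (lift_form f) v W = sat f v W.
Proof.
elim: f v W => //= {n m}.
- by move=> n m f IH v W; rewrite IH.
- by move=> n m f IHf g IHg v W; rewrite IHf IHg.
- by move=> n m f IH v W; apply: eq_existsb => a; exact: IH.
- by move=> n m f IH v W; apply: eq_existsb => a; exact: IH.
Qed.

Definition is_colour s n m : form (colour_voc s) n m.+1 :=
  let mem_X := FMem (colour_voc s) (ord0 : 'I_n.+1) (ord0 : 'I_m.+1) in
  let col := @FRel (colour_voc s) n.+1 m.+1 (inr tt) [tuple ord0] in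
  FAll1 (FOr (FAnd mem_X col) (FAnd (FNot mem_X) (FNot col))).

Lemma sat_is_colour s (A : struct s) C n m
    (v : 'I_n -> univ A) (W : 'I_m.+1 -> {set univ A}) :
  @sat _ (colour_struct C) n m.+1 (is_colour s n m) v W = (W ord0 == C).
Proof.
rewrite sat_all1; apply/forallP/eqP => [h|e a].
  apply/setP => a; have := h a; rewrite sat_or /= tnth_map /= [tnth _ _]/= ext0.
  by case: (a \in W _); case: (a \in C).
by rewrite sat_or /= tnth_map /= [tnth _ _]/= ext0 e; case: (a \in C).
Qed.

(** A colour is a relation name and cannot stand where a formula asks for a set variable, for
    instance under the parity test. So the variable is bound and forced to equal the colour. *)
Definition subst_colour s n m (f : form s n m.+1) : form (colour_voc s) n m :=
  FEx2 (FAnd (is_colour s n m) (lift_form f)).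

Lemma sat_subst_colour s (A : struct s) C n m (f : form s n m.+1)
    (v : 'I_n -> univ A) (W : 'I_m -> {set univ A}) :
  @sat _ (colour_struct C) n m (subst_colour f) v W = sat f v (ext C W).
Proof.
pose A' := colour_struct C.
rewrite -[LHS]/[exists X : {set univ A}, @sat _ A' _ _ (is_colour s n m) v (ext X W)
  && @sat _ A' _ _ (lift_form f) v (ext X W)].
apply/existsP/idP => [[X]|h]; last exists C;
  by rewrite sat_is_colour ext0 sat_lift ?eqxx // => /andP [/eqP ->].
Qed.

Section WithoutSets.
Variable R : Type.
Variable ar : R -> nat.

Definition rvoc := @Voc R ar Empty_set (fun e => match e with end).

Definition rstruct (U : finType) (ri : forall r : R, pred ((ar r).-tuple U)) : struct rvoc :=
  @Struct rvoc U ri (fun p => match p with end).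

End WithoutSets.

(** The parameters are guessed by colouring, one for each step of an induction on their number;
    [subst_colour] removes a variable each time, and with none left [phi] becomes a filter followed
    by an interpretation. The equivalence describes all outputs, so it serves both non-emptiness and
    correctness. *)
Lemma param_interp R (ar : R -> nat) p : forall s s'' (phi : form s 0 p)
    (fr : forall r : R, form s (ar r) p) (t1 : trans (rvoc ar) s''),
  exists t : trans s s'', forall A B, tsem t A B <->
    exists W : 'I_p -> {set univ A}, sat phi (nilval (univ A)) W /\
      tsem t1 (@rstruct R ar (univ A) (fun r x => sat (fr r) (tnth x) W)) B.
Proof.
elim: p => [|p IH] s s'' phi fr t1.
  exists (TCons (AFilter phi)
    (TCons (@AInterp s (rvoc ar) fr (fun e => match e with end)) t1)) => A B.
  have eqS (W : 'I_0 -> {set univ A}) : @interp_struct s (rvoc ar) A fr (fun e => match e with end)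
     = @rstruct R ar (univ A) (fun r x => sat (fr r) (tnth x) W).
    rewrite /interp_struct /rstruct (eq_fun_ord0 (nilval {set univ A}) W); congr Struct.
    by apply: functional_extensionality_dep => -[].
  split=> /=.
    move=> [C [[-> h] [C' [-> h']]]]; exists (nilval _); split=> //.
    by rewrite -(eqS (nilval _)).
  move=> [W [h h']]; exists A; split; first by rewrite (eq_fun_ord0 (nilval _) W).
  by eexists; split; first reflexivity; rewrite (eqS W).
have [t ht] := IH _ _ (subst_colour phi) (fun r => subst_colour (fr r)) t1.
exists (TCons (AColour s) t) => A B.
have eqS (C : {set univ A}) W :
    @rstruct R ar (univ A) (fun r x =>
      @sat _ (colour_struct C) _ _ (subst_colour (fr r)) (tnth x) W)
    = @rstruct R ar (univ A) (fun r x => sat (fr r) (tnth x) (ext C W)).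
  congr rstruct; apply: functional_extensionality_dep => r.
  by apply: functional_extensionality_dep => x; rewrite sat_subst_colour.
split=> /=.
  move=> [A' [[C ->] /ht [W [h1 h2]]]]; exists (ext C W).
  by rewrite -(@sat_subst_colour s A C) -eqS; split.
move=> [W]; rewrite -(ext_split W) => -[h1 h2].
exists (colour_struct (W ord0)); split; first by exists (W ord0).
apply/ht; exists (fun i => W (lift ord0 i)).
by rewrite (@sat_subst_colour s A) eqS; split.
Qed.

(** * Transductions producing named elements *)

Section Codes.
Variable K : finType.

Definition code_rel := (K + dsym * K * K)%type.
Definition code_ar (r : code_rel) := match r with inl _ => 1 | inr _ => 2 end.
Definition code_voc := rvoc code_ar.
Definition valid_ar (q : option dsym) := if q is Some _ then 2 else 1.
Definition valid_voc := rvoc valid_ar.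

Definition code_copy := copy_voc code_voc #|K|.

Definition f_copy n (c : K) (x z : 'I_n) : form code_copy n 0 :=
  @FRel code_copy n 0 (inr (enum_rank c)) [tuple x; z].

Definition f_valid : form code_copy 1 0 :=
  FAny (fun c => FEx1 (FAnd (f_copy c ord0 ord_max)
    (@FRel code_copy 2 0 (inl (inl c)) [tuple ord0]))).

(** Variables 2 and 3 are the two arguments; the bound variables 1 and 0 are the originals of which
    they are copies. *)
Definition f_rel (q : dsym) : form code_copy 2 0 :=
  FAny (fun c => FAny (fun c' => FEx1 (FEx1 (FAnd (FAnd
    (f_copy c (inord 1) (inord 2)) (f_copy c' (inord 0) (inord 3)))
    (@FRel code_copy 4 0 (inl (inr (q, c, c'))) [tuple inord 1; inord 0]))))).

Definition f_code (q : option dsym) : form code_copy (valid_ar q) 0 :=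
  match q return form code_copy (valid_ar q) 0 with
  | None => f_valid | Some q => f_rel q end.

(** Every vertex gets one copy per code, and only the valid copies survive. The relations on codes
    live on the original vertices, which the restriction deletes; so the first interpretation moves
    both validity and the final relations to the copies, and the last one merely forgets
    validity. *)
Definition code_trans : trans code_voc decomp_voc :=
  TCons (ACopy code_voc #|K|)
  (TCons (@AInterp code_copy valid_voc f_code (fun e => match e with end))
  (TCons (ARestrict (@FRel valid_voc 1 0 None [tuple ord0]))
  (TCons (@AInterp valid_voc decomp_voc
     (fun q => @FRel valid_voc 2 0 (Some q) [tuple ord0; ord_max])
     (fun e => match e with end))
  (TNil decomp_voc)))).

Variables (U : finType) (valid : K -> U -> bool) (rel : dsym -> K -> K -> U -> U -> bool).

Definition code_struct : struct code_voc :=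
  @rstruct code_rel code_ar U (fun r => match r return pred ((code_ar r).-tuple U) with
    | inl c => fun t => valid c (tnth t ord0)
    | inr (q, c, c') => fun t => rel q c c' (tnth t ord0) (tnth t ord_max) end).

Variable D : struct decomp_voc.
Variable den : K -> U -> univ D -> Prop.
Hypothesis validP : forall c x, valid c x <-> exists S, den c x S.
Hypothesis relP : forall q c c' x x', rel q c c' x x' <->
  exists S S', [/\ den c x S, den c' x' S' & @rint _ D q [tuple S; S']].
Hypothesis den_fun : forall c x S S', den c x S -> den c x S' -> S = S'.
Hypothesis den_inj : forall c c' x x' S, den c x S -> den c' x' S -> c = c' /\ x = x'.
Hypothesis den_surj : forall S, exists c x, den c x S.

Notation Z := (U * 'I_#|K|.+1)%type.

Definition code_of c (x : U) : Z := (x, lift ord0 (enum_rank c)).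

Lemma code_of_inj c c' x x' : code_of c x = code_of c' x' -> c = c' /\ x = x'.
Proof. by case=> -> e; move: (ord_inj e) => /enum_rank_inj. Qed.

Let cs := copy_struct code_struct #|K|.

Lemma sat_f_copy n c (x z : 'I_n) (v : 'I_n -> Z) (W : 'I_0 -> {set Z}) :
  @sat code_copy cs n 0 (f_copy c x z) v W =
  ((v x).2 == ord0) && (v z == code_of c (v x).1).
Proof.
rewrite -[LHS]/[&& (v x).2 == ord0, (v z).1 == (v x).1 & (v z).2 == lift ord0 (enum_rank c)].
by rewrite /code_of; case: (v z) => a b; rewrite xpair_eqE.
Qed.

Lemma sat_f_valid (v : 'I_1 -> Z) (W : 'I_0 -> {set Z}) :
  @sat code_copy cs 1 0 f_valid v W = [exists c, exists x, (v ord0 == code_of c x) && valid c x].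
Proof.
rewrite /f_valid sat_any; apply: eq_existsb => c.
rewrite -[LHS]/[exists a : Z, @sat code_copy cs 2 0 (f_copy c ord0 ord_max) (ext a v) W &&
  (((ext a v ord0).2 == ord0) && true && valid c (ext a v ord0).1)].
have em : ord_max = lift ord0 ord0 :> 'I_2 by exact: val_inj.
apply/existsP/existsP => [[a]|[x /andP [/eqP h1 h2]]].
  rewrite sat_f_copy em ext_lift ext0 => /andP [/andP [_ h1] /andP [_ h2]].
  by exists a.1; rewrite h1 h2.
by exists (x, ord0); rewrite sat_f_copy em ext_lift ext0 /= h1 h2 !eqxx.
Qed.

Lemma sat_f_rel q (v : 'I_2 -> Z) (W : 'I_0 -> {set Z}) :
  @sat code_copy cs 2 0 (f_rel q) v W = [exists c, exists c', exists x, exists x',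
    [&& v ord0 == code_of c x, v ord_max == code_of c' x' & rel q c c' x x']].
Proof.
rewrite /f_rel sat_any; apply: eq_existsb => c; rewrite sat_any; apply: eq_existsb => c'.
set i0 := inord 0 : 'I_4; set i1 := inord 1 : 'I_4.
set i2 := inord 2 : 'I_4; set i3 := inord 3 : 'I_4.
have e0 : i0 = ord0 by apply: ord_inj; rewrite inordK.
have e1 : i1 = lift ord0 ord0 by apply: ord_inj; rewrite inordK.
have e2 : i2 = lift ord0 (lift ord0 ord0) by apply: ord_inj; rewrite inordK.
have e3 : i3 = lift ord0 (lift ord0 ord_max) by apply: ord_inj; rewrite inordK.
rewrite -[LHS]/[exists a : Z, exists a' : Z,
  (@sat code_copy cs 4 0 (f_copy c i1 i2) (ext a' (ext a v)) W &&
   @sat code_copy cs 4 0 (f_copy c' i0 i3) (ext a' (ext a v)) W) &&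
  (((ext a' (ext a v) i1).2 == ord0) && (((ext a' (ext a v) i0).2 == ord0) && true)
   && rel q c c' (ext a' (ext a v) i1).1 (ext a' (ext a v) i0).1)].
apply/existsP/existsP => [[a /existsP [a']]|[x /existsP [x']]].
  rewrite !sat_f_copy e0 e1 e2 e3 !ext_lift !ext0.
  move=> /andP [/andP [/andP [_ h1] /andP [_ h2]] /andP [_ h3]].
  by exists a.1; apply/existsP; exists a'.1; rewrite h1 h2 h3.
move=> /and3P [/eqP h1 /eqP h2 h3].
exists (x, ord0); apply/existsP; exists (x', ord0).
by rewrite !sat_f_copy e0 e1 e2 e3 !ext_lift !ext0 /= h1 h2 !eqxx h3.
Qed.

Definition decoded (z : Z) := [exists c, exists x, (z == code_of c x) && valid c x].
Definition decoded_rel q (z z' : Z) := [exists c, exists c', exists x, exists x',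
    [&& z == code_of c x, z' == code_of c' x' & rel q c c' x x']].

Lemma code_trans_ex : exists B, tsem code_trans code_struct B.
Proof. by eexists; do 4!(eexists; split; first reflexivity); reflexivity. Qed.

(** A surviving copy is sent to the element that its code denotes. This is a bijection by [den_inj],
    [den_surj] and [den_fun], and [relP] carries the relations over. *)
Lemma code_trans_iso B : tsem code_trans code_struct B -> iso B D.
Proof.
move=> /= [_ [-> [_ [-> [_ [-> [_ [-> ->]]]]]]]].
set P := (fun x : _ => _ : bool).
have PE z : P z = decoded z by exact: sat_f_valid.
have spec (z : {z | P z}) : exists S c x, val z = code_of c x /\ den c x S.
  have := valP z; rewrite PE => /existsP [c /existsP [x /andP [/eqP h /validP [S hS]]]].
  by exists S, c, x.
have [f fP] := fin_all_exists spec.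
have speci (S : univ D) : exists z : {z | P z}, exists c x, val z = code_of c x /\ den c x S.
  have [c [x h]] := den_surj S.
  have Pz : P (code_of c x).
    rewrite PE; apply/existsP; exists c; apply/existsP; exists x.
    by rewrite eqxx; apply/validP; exists S.
  by exists (Sub (code_of c x) Pz), c, x.
have [g gP] := fin_all_exists speci.
exists f; split; last by case.
  exists g => [z|S].
    have [c [x [h1 h2]]] := fP z; have [c' [x' [h3 h4]]] := gP (f z).
    apply: val_inj; rewrite h1 h3.
    by have [-> ->] := den_inj h2 h4.
  have [c [x [h1 h2]]] := fP (g S); have [c' [x' [h3 h4]]] := gP S.
  move: h1; rewrite h3 => /code_of_inj [ec ex]; subst.
  exact: den_fun h2 h4.
move=> q t; pose a := tnth t ord0; pose b := tnth t ord_max.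
have -> : rint D q (map_tuple f t) = rint D q [tuple f a; f b].
  congr rint; apply: eq_from_tnth => i; rewrite tnth_map.
  case: (unliftP ord0 i) => [k|] -> //; rewrite (ord1 k) [RHS]/= /b.
  by congr (f (tnth t _)); apply: val_inj.
suff <- : decoded_rel q (val a) (val b) = rint D q [tuple f a; f b] by exact: sat_f_rel.
have [c [x [h1 h2]]] := fP a; have [c' [x' [h3 h4]]] := fP b.
rewrite h1 h3; apply/idP/idP => [|h].
  move=> /existsP [c1 /existsP [c1' /existsP [x1 /existsP [x1' /and3P [/eqP e1 /eqP e2]]]]].
    move=> /relP [S [S' [k1 k2 k3]]].
  move: (code_of_inj e1) (code_of_inj e2) => [? ?] [? ?]; subst c1 x1 c1' x1'.
  by rewrite (den_fun h2 k1) (den_fun h4 k2).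
apply/existsP; exists c; apply/existsP; exists c'.
apply/existsP; exists x; apply/existsP; exists x'.
by rewrite !eqxx; apply/relP; exists (f a), (f b).
Qed.

End Codes.

(** * Components of a tree *)

Lemma connect_invariant (T : finType) (e : rel T) (P : pred T) x y :
  (forall a b, P a -> e a b -> P b) -> P x -> connect e x y -> P y.
Proof.
move=> h Px /connectP [p + ->]; elim: p x Px => //= a p IH x Px /andP [exa].
by apply: IH; exact: h exa.
Qed.

Lemma comp_edge_swap (N : finType) (adj : rel N) (u v w : N) :
  comp_edge adj u v w = comp_edge adj v u w.
Proof. by apply/setP => y; rewrite !inE; apply: eq_connect => a b; rewrite orbC. Qed.

Section Tree.
Variables (N : finType) (adj : rel N).
Hypothesis tree : is_tree adj.

Let adj_sym : symmetric adj. Proof. by case: tree. Qed.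
Let adj_irr : irreflexive adj. Proof. by case: tree. Qed.

Lemma adj_neq u v : adj u v -> u != v.
Proof. by apply: contraTneq => ->; rewrite adj_irr. Qed.

Definition avoid u : rel N := fun a b => [&& adj a b, a != u & b != u].

Lemma avoid_sym u : symmetric (avoid u).
Proof. by move=> a b; rewrite /avoid adj_sym; case: adj => //=; rewrite andbC. Qed.

Lemma in_comp u v z : (z \in comp_node adj u v) = connect (avoid u) v z.
Proof. by rewrite inE. Qed.

Lemma comp_refl u v : v \in comp_node adj u v.
Proof. by rewrite in_comp connect0. Qed.

Lemma comp_neq u v z : v != u -> z \in comp_node adj u v -> z != u.
Proof.
move=> vu; rewrite in_comp.
by apply: (connect_invariant (P := fun z => z != u)) => // a b _ /and3P [].
Qed.

Lemma comp_step u v a b : v != u ->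
  a \in comp_node adj u v -> adj a b -> b != u -> b \in comp_node adj u v.
Proof.
move=> vu ha ab bu; have au := comp_neq vu ha.
move: ha; rewrite !in_comp => /connect_trans; apply; apply: connect1.
by rewrite /avoid ab au.
Qed.

(* Two neighbours of [u] joined by a path avoiding [u] close a cycle through [u]. *)
Lemma comp_disjoint u v w z : adj u v -> adj u w ->
  z \in comp_node adj u v -> z \in comp_node adj u w -> v = w.
Proof.
move=> uv uw; rewrite !in_comp => vz wz; apply/eqP; apply: contraT => vw.
have : connect (avoid u) v w.
  by apply: connect_trans vz _; rewrite (sym_connect_sym (@avoid_sym u)).
case/connectP => p0 /shortenP [p hp up _ lw]; case: tree => _ _ _ []; exists [:: u, v & p].
have vu : v != u by rewrite eq_sym adj_neq.
have pu : u \notin v :: p.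
  rewrite inE negb_or eq_sym vu /=; apply/negP => up'.
  have : path (avoid u) v p := hp.
  by case/splitPr: up' => p1 p2; rewrite cat_path /= /avoid eqxx !andbF.
split.
- by case: p lw {hp up pu} => //= e; rewrite e eqxx in vw.
- by rewrite cons_uniq pu.
- rewrite /= uv /= rcons_path -lw adj_sym uw andbT.
  by apply: sub_path hp => a b /and3P [].
Qed.

(** A simple path from [u] to [x] never returns to [u], so after its first step it stays inside one
    component of the tree without [u]. *)
Lemma comp_cover_from v u x : v != u -> x \in comp_node adj v u -> x != u ->
  exists z, [/\ adj u z, z != v & x \in comp_node adj u z].
Proof.
move=> vu; rewrite in_comp => /connectP [p0 /shortenP [[|z p] hp up _ ->]].
  by rewrite eqxx.
move=> _; move: hp up => /= /andP [/and3P [uz _ zv] hp] /and3P [pu zp _].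
exists z; split=> //; rewrite in_comp; apply/connectP; exists p => //.
move: pu; rewrite inE negb_or => /andP [uz' pu].
elim: p z {zp uz zv} uz' pu hp => //= a p IH z uz'; rewrite inE negb_or => /andP [ua up].
by move=> /andP [/and3P [h1 _ h2] /IH ->] //; rewrite /avoid h1 eq_sym uz' eq_sym ua.
Qed.

Lemma comp_cover u x : x != u -> exists2 z, adj u z & x \in comp_node adj u z.
Proof.
move=> xu; have : connect adj u x by case: tree.
case/connectP => p0 /shortenP [[|z p] hp up _ ex]; first by rewrite ex eqxx in xu.
move: hp up ex => /= /andP [uz hp] /and3P [pu zp _] ->.
exists z => //; rewrite in_comp; apply/connectP; exists p => //.
move: pu; rewrite inE negb_or => /andP [uz' pu].
elim: p z {zp uz} uz' pu hp => //= a p IH z uz'; rewrite inE negb_or => /andP [ua up].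
by move=> /andP [h1 /IH ->] //; rewrite /avoid h1 eq_sym uz' eq_sym ua.
Qed.

(** A node that is not behind [v] is [u] itself or lies behind another neighbour [z] of [u]; the
    path to it through [z] cannot meet [v]. Conversely, a node on both sides would lie behind two
    different neighbours of [u]. *)
Lemma compC u v : adj u v -> ~: comp_node adj u v = comp_node adj v u.
Proof.
move=> uv; have vu : v != u by rewrite eq_sym adj_neq.
have uv' : u != v by rewrite eq_sym.
apply/setP => x; rewrite inE; apply/idP/idP => [hx|hx].
  have [->|xu] := eqVneq x u; first exact: comp_refl.
  have [z uz xz] := comp_cover xu.
  have zu : z != u by rewrite eq_sym adj_neq.
  have zv : z != v by apply: contraNneq hx => <-.
  have nv : v \notin comp_node adj u z.
    by apply: contra zv => h; apply/eqP; apply: (comp_disjoint uz uv h); exact: comp_refl.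
  have : (x \in comp_node adj u z) && (x \in comp_node adj v u); last by case/andP.
  have : connect (avoid u) z x by rewrite -in_comp.
  apply: (connect_invariant
    (P := fun x => (x \in comp_node adj u z) && (x \in comp_node adj v u))).
    move=> a b /andP [ha hb] /and3P [ab au bu].
    have hb' := comp_step zu ha ab bu; rewrite hb' (comp_step _ hb ab) //.
    by apply: contraNneq nv => <-.
  rewrite comp_refl (comp_step _ (comp_refl v u)) //.
apply/negP => hx'; have xu := comp_neq vu hx'.
have [z [uz zv xz]] := comp_cover_from vu hx xu.
by move: zv; rewrite (comp_disjoint uz uv xz hx') eqxx.
Qed.

(** A walk from [w] that avoids [u'] never meets [u], so it cannot leave the component of [p], which
    it enters next to [u']. *)
Lemma comp_sub u p u' w : adj u p -> adj u' w ->
  u' \in comp_node adj u p -> u \notin comp_node adj u' w ->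
  comp_node adj u' w \subset comp_node adj u p.
Proof.
move=> up uw hu' hu; apply/subsetP => x.
have pu : p != u by rewrite eq_sym adj_neq.
have wu : w != u' by rewrite eq_sym adj_neq.
move=> hx; have h : connect (avoid u') w x by rewrite -in_comp.
have : (x \in comp_node adj u' w) && (x \in comp_node adj u p); last by case/andP.
apply: (connect_invariant
  (P := fun x => (x \in comp_node adj u' w) && (x \in comp_node adj u p))) h.
  move=> a b /andP [ha hb] /and3P [ab au bu].
  have hb' := comp_step wu ha ab bu; rewrite hb' (comp_step pu hb ab) //.
  by apply: contraNneq hu => <-.
rewrite comp_refl (comp_step pu hu' uw) //.
by apply: contraNneq hu => <-; exact: comp_refl.
Qed.

(** Deleting the edge or deleting the node [u] gives the same part around [v]: escaping to [u] by
    another edge would need a second neighbour of [u] in that part. *)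
Lemma comp_edgeE u v : adj u v -> comp_edge adj u v v = comp_node adj u v.
Proof.
move=> uv; have vu : v != u by rewrite eq_sym adj_neq.
apply/setP => x; rewrite inE; apply/idP/idP.
  apply: (connect_invariant (P := [in comp_node adj u v])); last exact: comp_refl.
  move=> a b ha /andP [ab ne]; apply: (comp_step vu ha ab).
  apply: contraNneq ne => bu; subst b.
  have ua : adj u a by rewrite adj_sym.
  by rewrite (comp_disjoint ua uv (comp_refl u a) ha) !eqxx orbT.
rewrite in_comp; apply: connect_sub => a b /and3P [ab au bu]; apply: connect1.
by rewrite ab (negbTE au) (negbTE bu) !andbF.
Qed.

Lemma comp_edgeE' u v : adj u v -> comp_edge adj u v u = comp_node adj v u.
Proof.
move=> uv; rewrite -comp_edgeE; last by rewrite adj_sym.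
exact: comp_edge_swap.
Qed.

End Tree.

(** * Strong sets and the enriched decomposition *)

Section StrongSets.
Variables (V : finType) (E : rel V).
Implicit Types X Y Z S : {set V}.

(** Written with quantifiers, membership and [E] only, so that a formula can be read off. The four
    sets may reach outside their sides: cutting them down does not change the condition on [x] in
    [X] and [y] outside [X]. *)
Definition splitb X := [&& [exists x, x \in X], [exists x, x \notin X] &
  [exists Xi : {set V}, exists Xo : {set V}, exists Yi : {set V}, exists Yo : {set V},
   [forall x, forall y, (x \in X) && (y \notin X) ==>
     ((E x y == (x \in Xo) && (y \in Yi)) && (E y x == (y \in Yo) && (x \in Xi)))]]].

Definition overlapb X Y := [&& [exists z, (z \in X) && (z \in Y)],
  [exists z, (z \in X) && (z \notin Y)], [exists z, (z \notin X) && (z \in Y)] &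
  [exists z, (z \notin X) && (z \notin Y)]].

Definition strongb X := splitb X && [forall Y, splitb Y ==> ~~ overlapb X Y].

Lemma splitbP X : reflect (is_split E X (~: X)) (splitb X).
Proof.
apply: (iffP and3P) => [[/existsP [a ha] /existsP [b hb]]|[_ _ /set0Pn [a ha] /set0Pn [b hb]]].
  move=> /existsP [Xi /existsP [Xo /existsP [Yi /existsP [Yo /forallP h]]]].
  split; rewrite ?setICr ?setUCr //.
  - by apply/set0Pn; exists a.
  - by apply/set0Pn; exists b; rewrite inE.
  exists (Xi :&: X), (Xo :&: X), (Yi :&: ~: X), (Yo :&: ~: X).
  split; rewrite ?subsetIr // => x y hx; rewrite inE => hy.
  have /forallP/(_ y) := h x; rewrite hx hy /= => /andP [/eqP -> /eqP ->].
  by rewrite !inE hx hy !andbT.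
case=> [Xi [Xo [Yi [Yo [_ _ _ _ h]]]]]; split.
- by apply/existsP; exists a.
- by apply/existsP; exists b; rewrite inE in hb.
- apply/existsP; exists Xi; apply/existsP; exists Xo; apply/existsP; exists Yi.
  apply/existsP; exists Yo; apply/forallP => x; apply/forallP => y.
  apply/implyP => /andP [hx hy]; have [||-> ->] := h x y; rewrite ?inE //.
  by rewrite !eqxx.
Qed.

Lemma is_splitC X Y : is_split E X Y -> Y = ~: X.
Proof.
case=> h1 h2 _ _ _; apply/setP => x.
by move/setP/(_ x): h1; move/setP/(_ x): h2; rewrite !inE; do 2!case: (x \in _).
Qed.

Lemma is_split_sym X Y : is_split E X Y -> is_split E Y X.
Proof.
case=> h1 h2 h3 h4 [Xi [Xo [Yi [Yo [k1 k2 k3 k4 k5]]]]].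
split; rewrite 1?setIC 1?setUC //; exists Yi, Yo, Xi, Xo; split=> // x y hx hy.
by have [] := k5 y x hy hx.
Qed.

Lemma overlapbP X Y : reflect (overlap X (~: X) Y (~: Y)) (overlapb X Y).
Proof.
apply: (iffP and4P) => -[h1 h2 h3 h4].
  by split; [case/existsP: h1|case/existsP: h2|case/existsP: h3|case/existsP: h4] => z hz;
    apply/set0Pn; exists z; rewrite !inE.
by split; [case/set0Pn: h1|case/set0Pn: h2|case/set0Pn: h3|case/set0Pn: h4] => z;
  rewrite !inE => hz; apply/existsP; exists z.
Qed.

Lemma strongbP X : reflect (strong_split E X (~: X)) (strongb X).
Proof.
apply: (iffP andP) => -[/splitbP h1 h2]; split=> //.
  move=> X' Y' s; have e := is_splitC s; subst Y'.
  by move/overlapbP; apply/negP; apply: implyP (forallP h2 X') _; apply/splitbP.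
by apply/forallP => Y; apply/implyP => /splitbP s; apply/negP => /overlapbP; exact: h2.
Qed.

Lemma overlap_sym X Y X' Y' : overlap X Y X' Y' -> overlap Y X X' Y'.
Proof. by case. Qed.

Lemma strong_split_sym X Y : strong_split E X Y -> strong_split E Y X.
Proof.
case=> /is_split_sym h1 h2; split=> // X' Y' s /overlap_sym; exact: h2.
Qed.

Lemma strongC X : strongb (~: X) = strongb X.
Proof.
by apply/strongbP/strongbP => /strong_split_sym; rewrite setCK.
Qed.

Lemma strong_neq0 X : strongb X -> X != set0.
Proof. by case/strongbP => -[]. Qed.

Lemma strong_neqT X : strongb X -> X != setT.
Proof. by rewrite -strongC => /strong_neq0; apply: contraNneq => ->; rewrite setCT. Qed.

(** Each alternative says that one of the four corners is empty; with all four non-empty the two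
    splits would overlap. *)
Lemma strong_cross X Y : strongb X -> strongb Y ->
  [\/ [disjoint X & Y], X \subset Y, Y \subset X | X :|: Y = setT].
Proof.
move=> /strongbP [_ h] /strongbP [hY _]; have no := h _ _ hY.
have [d|d] := boolP [disjoint X & Y]; first by constructor 1.
have [s1|s1] := boolP (X \subset Y); first by constructor 2.
have [s2|s2] := boolP (Y \subset X); first by constructor 3.
constructor 4; apply/eqP; apply: contraT => t; case: no; split.
- by rewrite setI_eq0.
- by rewrite -setDE setD_eq0.
- by rewrite setIC -setDE setD_eq0.
- by rewrite -setCU; apply: contra t => /eqP e; rewrite -[_ :|: _]setCK e setC0.
Qed.

(** A singleton cannot meet both sides of a bipartition, so it overlaps nothing; it gives a split
    with the in- and out-neighbourhoods of [x] on the other side. *)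
Lemma strong_set1 x : 1 < #|V| -> strongb [set x].
Proof.
move=> V1; apply/strongbP; split; last first.
  move=> X Y hs [/set0Pn [a] /[!inE] /andP [/eqP -> h1] /set0Pn [b] /[!inE] /andP [/eqP -> h2] _ _].
  by have := is_splitC hs => e; rewrite e inE h1 in h2.
apply/splitbP; apply/and3P; split.
- by apply/existsP; exists x; rewrite inE.
- have : 0 < #|~: [set x]| by rewrite cardsCs setCK cards1 subn_gt0.
  by case/card_gt0P => y; rewrite inE => hy; apply/existsP; exists y.
apply/existsP; exists [set x]; apply/existsP; exists [set x].
apply/existsP; exists [set y | E x y]; apply/existsP; exists [set y | E y x].
apply/forallP => a; apply/forallP => y; apply/implyP; rewrite !inE => /andP [/eqP -> _].
by rewrite eqxx andbT !eqxx.
Qed.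

(* [S] and [S'] are the leaf sets behind two different edges of the same node. *)
Definition cedgeb S S' := [&& [forall z, ~~ ((z \in S) && (z \in S'))],
  [exists z, (z \notin S) && (z \notin S')],
  [forall Z : {set V}, [&& strongb Z, S \subset Z & [forall z, ~~ ((z \in Z) && (z \in S'))]] ==>
     ((Z == S) || (Z == ~: S'))] &
  [exists x, exists y, [&& x \in S, y \in S' & E x y]]].

Lemma disjointE X Y : [forall z, ~~ ((z \in X) && (z \in Y))] = [disjoint X & Y].
Proof.
apply/forallP/pred0P => h z; first by apply/negbTE; exact: h.
by rewrite negbT //; exact: h.
Qed.

Definition strong_struct : struct decomp_voc :=
  Struct (s := decomp_voc) {S : {set V} | strongb S}
    (fun d t =>
       let S := val (tnth t ord0) in
       let S' := val (tnth t ord_max) in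
       match d with TEdge => S' == ~: S | CEdge => cedgeb S S' end)
    (fun p => match p with end).

End StrongSets.

Lemma upair_eqP (T : eqType) (X Y X' Y' : T) :
  reflect ((X = X' /\ Y = Y') \/ (X = Y' /\ Y = X')) (upair_eq X Y X' Y').
Proof.
apply: (iffP orP) => -[] => [/andP [/eqP -> /eqP ->]|/andP [/eqP -> /eqP ->]|[-> ->]|[-> ->]];
 rewrite ?eqxx; by [left|right].
Qed.

(** * Strong sets as leaf sets behind the edges of a split tree *)

Section Enriched.
Variables (V : finType) (E : rel V) (N : finType) (adj : rel N) (leaf : V -> N).
Hypothesis st : split_tree E adj leaf.

Local Notation L := (Lnode adj leaf).

Let tree : is_tree adj. Proof. by case: st => -[]. Qed.
Let adj_sym : symmetric adj. Proof. by case: tree. Qed.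

Let split2E u v : adj u v -> edge_split2 adj leaf u v = L u v.
Proof. by move=> uv; rewrite /edge_split2 comp_edgeE. Qed.

Let split1E u v : adj u v -> edge_split1 adj leaf u v = L v u.
Proof. by move=> uv; rewrite /edge_split1 comp_edgeE'. Qed.

Let in_L u v x : (x \in L u v) = (leaf x \in comp_node adj u v).
Proof. by rewrite /Lnode /leaves_of in_set. Qed.

Let LC u v : adj u v -> ~: L u v = L v u.
Proof. by move=> uv; apply/setP => x; rewrite in_setC !in_L -(compC tree uv) in_setC. Qed.

Let LS u p u' w : comp_node adj u' w \subset comp_node adj u p -> L u' w \subset L u p.
Proof. by move=> h; apply/subsetP => x; rewrite !in_L; exact: (subsetP h). Qed.

Lemma L_strong u v : adj u v -> strongb E (L u v).
Proof.
move=> uv; apply/strongbP; rewrite (LC uv); case: st => _ [h _ _].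
by have := h v u; rewrite split1E ?split2E ?(adj_sym v u) //; apply.
Qed.

Lemma L_neq0 u v : adj u v -> exists x, x \in L u v.
Proof. by move=> uv; apply/set0Pn; apply: strong_neq0; exact: L_strong. Qed.

(** The split tree separates edges only as unordered pairs. If the two edges agreed with opposite
    orientations, a non-empty leaf set would equal its complement. *)
Lemma L_inj u v u' v' : adj u v -> adj u' v' -> L u v = L u' v' -> u = u' /\ v = v'.
Proof.
move=> uv uv' e; case: st => _ [_ /(_ _ _ _ _ uv uv') h _].
have : upair_eq u v u' v'.
  by apply: h; rewrite !split1E // !split2E // -(LC uv) -(LC uv') e; apply/upair_eqP; left.
case/upair_eqP => -[? ?]; first by [].
subst v' u'; move/setP: e; have [x hx] := L_neq0 uv => /(_ x).
by rewrite hx -LC // inE hx.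
Qed.

Lemma L_surj S : strongb E S -> exists u v, adj u v /\ L u v = S.
Proof.
move/strongbP => s; case: st => _ [_ _ /(_ _ _ s) [u [v [uv /upair_eqP]]]].
rewrite split1E // split2E // => -[] [h1 h2]; last by exists u, v.
by exists v, u; rewrite adj_sym.
Qed.

Lemma L_disjoint u v w : adj u v -> adj u w -> v != w -> [disjoint L u v & L u w].
Proof.
move=> uv uw vw; apply/pred0P => x /=; apply/negP => /andP [].
by rewrite !in_L => h1 h2; move: vw; rewrite (comp_disjoint tree uv uw h1 h2) eqxx.
Qed.

Lemma leaf_neighbour u v w : u \in codom leaf -> adj u v -> adj u w -> v = w.
Proof.
case: st => -[_ _ <- _] _; rewrite /deg => h uv uw; apply/eqP; apply: contraT => vw.
suff : 2 <= #|[set y | adj u y]| by rewrite leqNgt ltnS h.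
have <- : #|[set v; w]| = 2 by rewrite cards2 vw.
by apply: subset_leq_card; apply/subsetP => z; rewrite !inE => /orP [] /eqP ->.
Qed.

Lemma inner_of_two u v w : adj u v -> adj u w -> v != w -> u \notin codom leaf.
Proof. by move=> uv uw; apply: contraNN => h; rewrite (leaf_neighbour h uv uw). Qed.

Lemma third_neighbour u v w : adj u v -> adj u w -> v != w ->
  exists z, [/\ adj u z, z != v & z != w].
Proof.
move=> uv uw vw; have hu := inner_of_two uv uw vw.
have d3 : 3 <= #|[set y | adj u y]| by case: st => -[_ _ _ /(_ u hu)].
have : 0 < #|[set y | adj u y] :\: [set v; w]|.
  rewrite cardsD subn_gt0; apply: leq_trans d3.
  by rewrite ltnS (leq_trans (subset_leq_card (subsetIr _ _))) // cards2 vw.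
case/card_gt0P => z; rewrite !inE negb_or => /andP [/andP [zv zw] uz].
by exists z.
Qed.

(** A third neighbour of [u] supplies the vertex outside both sets. A strong set in between is some
    [L a b]. If the edge [ab] misses [u], it lies behind one neighbour [z], and [L a b] or its
    complement is inside [L u z]; this forces [z] to be [v] or [w] and the inclusion to be an
    equality. *)
Lemma cedge_of_adj u v w : adj u v -> adj u w -> v != w ->
  [exists x, exists y, [&& x \in L u v, y \in L u w & E x y]] ->
  cedgeb E (L u v) (L u w).
Proof.
move=> uv uw vw ex; rewrite /cedgeb disjointE L_disjoint //= ex andbT; apply/andP; split.
  have [z [uz zv zw]] := third_neighbour uv uw vw; have [x hx] := L_neq0 uz.
  apply/existsP; exists x.
  by rewrite (disjointFr (L_disjoint uz uv zv) hx) (disjointFr (L_disjoint uz uw zw) hx).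
apply/forallP => Z; apply/implyP => /and3P [/L_surj [a [b [ab <-]]] sZ]; rewrite disjointE => dZ.
have [x hx] := L_neq0 uv; have [y hy] := L_neq0 uw.
have nbr z : adj u z -> (exists2 t, t \in L u v & t \in L u z) -> z = v.
  move=> uz [t h1 h2]; apply/eqP; apply: contraT => zv.
  by rewrite (disjointFr (L_disjoint uz uv zv) h2) in h1.
have nbr' z : adj u z -> (exists2 t, t \in L u w & t \in L u z) -> z = w.
  move=> uz [t h1 h2]; apply/eqP; apply: contraT => zw.
  by rewrite (disjointFr (L_disjoint uz uw zw) h2) in h1.
have xZ := subsetP sZ _ hx.
have yZ : y \in L b a by rewrite -LC // inE (disjointFl dZ hy).
have [au|au] := eqVneq a u.
  by subst a; rewrite (nbr b) ?eqxx //; exists x.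
have [bu|bu] := eqVneq b u.
  subst b; rewrite (nbr' a) ?[adj u a]adj_sym //; last by exists y.
  by rewrite LC // eqxx orbT.
have [z uz az] := comp_cover tree au.
have zu : z != u by rewrite eq_sym (adj_neq tree).
have bz := comp_step zu az ab bu.
have [uab|uab] := boolP (u \in comp_node adj a b).
  have ba : adj b a by rewrite adj_sym.
  have uba : u \notin comp_node adj b a by rewrite -(compC tree ab) inE uab.
  have s := LS (comp_sub tree uz ba bz uba).
  have ez : z = w by apply: (nbr') => //; exists y => //; exact: (subsetP s).
  subst z; rewrite -(LC ba) (inj_eq (can_inj (@setCK _))) orbC.
  rewrite eqEsubset s /= -(LC ab) subsetC -disjoints_subset.
  by move: dZ; rewrite disjoint_sym disjoints_subset subsetC => ->.
have s := LS (comp_sub tree uz ab az uab).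
have ez : z = v by apply: nbr => //; exists x => //; exact: (subsetP s).
by subst z; rewrite eqEsubset s sZ.
Qed.

(** If [u] and [u'] differ, let [p] be the neighbour of [u] towards [u']. The edge between [u] and
    [p] then gives a further strong set [L p u] between [L u v] and the complement of [L u' w]. *)
Lemma adj_of_cedge u v u' w : adj u v -> adj u' w ->
  cedgeb E (L u v) (L u' w) -> u = u' /\ v != w.
Proof.
move=> uv uw; rewrite /cedgeb disjointE => /and4P [dS /existsP [t /andP [t1 t2]] /forallP bet _].
have eu : u = u'; last first.
  subst u'; split=> //; apply/eqP => e; subst w; have [x hx] := L_neq0 uv.
  by have := disjointFr dS hx; rewrite hx.
apply/eqP; apply: contraT => uu.
have u'u : u' != u by rewrite eq_sym.
have [p up hp] := comp_cover tree u'u.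
have [x hx] := L_neq0 uv; have [y hy] := L_neq0 uw.
have nvw : ~~ (L u v \subset L u' w).
  by apply/negP => /subsetP/(_ _ hx) hx'; rewrite (disjointFr dS hx) in hx'.
have nwv : ~~ (L u' w \subset L u v).
  by apply/negP => /subsetP/(_ _ hy) hy'; rewrite (disjointFl dS hy) in hy'.
(* If [p] were [v], then [u] would be behind [w], since the two sets are disjoint. A leaf [t]
   outside [L u v] is behind another neighbour of [u], hence behind [w] too, so the two sets would
   cover [V]. *)
have pv : p != v.
  apply/eqP => e; subst p.
  have h : u \in comp_node adj u' w.
    by apply: contraR nwv => h; apply: LS; exact: (comp_sub tree).
  have tu : leaf t != u by apply: contraNneq t2 => e; rewrite in_L e.
  have [z uz tz] := comp_cover tree tu.
  have zv : z != v by apply: contraNneq t1 => e; rewrite in_L -e.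
  have u'z : u' \notin comp_node adj u z.
    by apply: contra zv => h'; rewrite (comp_disjoint tree uz uv h' hp).
  by move: t2; rewrite in_L (subsetP (comp_sub tree uw uz h u'z) _ tz).
have pu : adj p u by rewrite adj_sym.
have u'v : u' \notin comp_node adj u v.
  by apply: contra pv => h'; rewrite (comp_disjoint tree up uv hp h').
have h : u \notin comp_node adj u' w.
  by apply: contra nvw => h; apply: LS; exact: (comp_sub tree).
have sw : L u' w \subset L u p by apply: LS; exact: (comp_sub tree).
(* Either equality of leaf sets identifies oriented edges by [L_inj], giving [p = u] or [u = u']. *)
have /orP [] : (L p u == L u v) || (L p u == ~: L u' w).
  apply: (implyP (bet (L p u))); rewrite L_strong //= disjointE -(LC up).
  rewrite -disjoints_subset L_disjoint 1?eq_sym //=.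
  by rewrite disjoint_sym disjoints_subset setCK.
  by move=> /eqP /(L_inj pu uv) [e _]; move: (adj_neq tree pu); rewrite e eqxx.
have wu : adj w u' by rewrite adj_sym.
by rewrite (LC uw) => /eqP /(L_inj pu wu) [_ e]; move: uu; rewrite e eqxx.
Qed.

Lemma iso_enriched : iso (strong_struct E) (enriched E adj leaf).
Proof.
have mk (S : {S | strongb E S}) :
    exists m : {p : N * N | adj p.1 p.2}, L (val m).1 (val m).2 = val S.
  by have [u [v [uv e]]] := L_surj (valP S); exists (Sub (u, v) uv).
have [f fP] := fin_all_exists mk.
have Lm (m : {p : N * N | adj p.1 p.2}) : strongb E (L (val m).1 (val m).2).
  by case: m => -[u v] uv; exact: L_strong.
exists f; split; last by case.
  exists (fun m => Sub (L (val m).1 (val m).2) (Lm m)) => [S|m].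
    by apply: val_inj => /=; rewrite fP.
  have := fP (Sub (L (val m).1 (val m).2) (Lm m)); move: (f _) => m' /= e.
  apply: val_inj; case: m m' e {Lm} => -[u v] uv [[u' v'] uv'] /= e.
  by have [-> ->] := @L_inj u' v' u v uv' uv e.
move=> d t; rewrite /= !tnth_map.
move: (tnth t ord0) (tnth t ord_max) => S S'; rewrite -(fP S) -(fP S').
case: (f S) (f S') => -[u v] /= uv [[u' w] /= uw] {S S' t}; case: d.
  rewrite LC //; have vu : adj v u by rewrite adj_sym.
  apply/eqP/andP => [/(L_inj uw vu) [-> ->]|[/eqP -> /eqP ->]] //; by rewrite !eqxx.
apply/idP/and4P => [h|[/eqP e _ vw ex]].
  have [e vw] := adj_of_cedge uv uw h; subst u'; split=> //.
    exact: inner_of_two vw.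
  case/and4P: h => _ _ _ /existsP [x /existsP [y /and3P [h1 h2 h3]]].
  by apply/exists_inP; exists x => //; apply/exists_inP; exists y.
subst u'; apply: cedge_of_adj => //.
case/exists_inP: ex => x h1 /exists_inP [y h2 h3].
by apply/existsP; exists x; apply/existsP; exists y; apply/and3P.
Qed.

End Enriched.

(** * Naming the members of a laminar family *)

Section Laminar.
Variables (V : finType) (F : {set {set V}}).
Implicit Types (X Y Z A C : {set V}).
Hypothesis laminar : forall X Y, X \in F -> Y \in F ->
  [\/ [disjoint X & Y], X \subset Y | Y \subset X].
Hypothesis singletons : forall X x, X \in F -> x \in X -> [set x] \in F.

(** For [x] in a member [Z] of [F] with at least two elements, the default [[set x]] is itself a
    candidate. By laminarity the children of [Z] partition it. *)
Definition child (Z : {set V}) x : {set V} :=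
  [arg max_(Y > [set x] | [&& Y \in F, x \in Y & Y \proper Z]) #|Y|].

Lemma childP Z x : Z \in F -> 1 < #|Z| -> x \in Z ->
  [/\ child Z x \in F, x \in child Z x, child Z x \proper Z &
      forall Y, Y \in F -> x \in Y -> Y \proper Z -> Y \subset child Z x].
Proof.
move=> ZF Z1 xZ; rewrite /child; case: arg_maxnP => [|C /and3P [CF xC CZ] max].
  rewrite (singletons ZF xZ) set11 properEcard sub1set xZ.
  by rewrite cards1.
split=> // Y YF xY YZ; have [d|//|s] := laminar YF CF.
  by rewrite (disjointFr d xY) in xC.
have le : #|Y| <= #|C| by apply: max; rewrite YF xY YZ.
by have /eqP <- : C == Y by rewrite eqEcard s le.
Qed.

Lemma child_eq Z x y : Z \in F -> 1 < #|Z| -> x \in Z -> y \in child Z x ->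
  child Z y = child Z x.
Proof.
move=> ZF Z1 xZ yC; have [h1 h2 h3 h4] := childP ZF Z1 xZ.
have yZ := subsetP (proper_sub h3) _ yC.
have [k1 k2 k3 k4] := childP ZF Z1 yZ.
have s : child Z x \subset child Z y by exact: k4.
by apply/eqP; rewrite eqEsubset s h4 // (subsetP s).
Qed.

Lemma two_children Z : Z \in F -> 1 < #|Z| ->
  exists x y, [/\ x \in Z, y \in Z & child Z x != child Z y].
Proof.
move=> ZF Z1; have /card_gt0P [x xZ] := ltnW Z1.
have [_ _ /properP [_ [y yZ yC]] _] := childP ZF Z1 xZ.
exists x, y; split=> //; apply: contraNneq yC => ->.
by have [] := childP ZF Z1 yZ.
Qed.

(* [col x i] is [None] if [x] is not an end of a path of class [i]; the two ends
   of a path get different booleans, [Some true] being the marked one. *)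
Definition colouring := V -> 'I_3 -> option bool.
Implicit Types col : colouring.

Definition coloured col i := [set x | col x i != None].
Definition marked col i := [set x | col x i == Some true].
Definition parity (A Z : {set V}) := odd #|Z :&: A|.

(** In the tree: class [i] uses every edge from the leaf [x] up to and including the edge above
    [Z]. *)
Definition chain col i x (Z : {set V}) := forall Y, Y \in F -> x \in Y -> Y \subset Z ->
  parity (coloured col i) Y.

(** The run of odd sets going up from the marked leaf [x] stops exactly at [X], where the path of
    [x] turns downwards. *)
Definition represents col i x (X : {set V}) := [/\ x \in X, x \in marked col i,
  ~~ parity (coloured col i) X &
  forall Y, Y \in F -> x \in Y -> Y \proper X -> parity (coloured col i) Y].

Definition coded col X :=
  exists i x, represents col i x X /\
    forall i' x', represents col i' x' X -> i' = i /\ x' = x.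

(** The end inside [Z] of the path of class [i] that enters [Z] from above: no other element of [Z]
    has a run of odd sets up through [Z]. *)
Definition end_of col i (Z : {set V}) b x := [/\ x \in Z, col x i = Some b, chain col i x Z &
  forall y, y \in Z -> chain col i y Z -> y = x].

(* [s i] tells whether a path of class [i] enters [Z] from above, and then the
   boolean of its end in [Z]. *)
Definition realizes col (Z : {set V}) (s : 'I_3 -> option bool) := [/\
  forall i, parity (coloured col i) Z = (s i != None),
  forall i b, s i = Some b -> exists x, end_of col i Z b x &
  forall X, X \in F -> X \subset Z -> 1 < #|X| -> coded col X].

Section Local.
Variables (col col' : colouring) (Z : {set V}).
Hypothesis agree : forall x, x \in Z -> col x = col' x.

(** What happens inside [Z] depends on the colours in [Z] alone, so colourings chosen separately for
    disjoint children can be glued. *)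
Lemma parity_local i X : X \subset Z ->
  parity (coloured col i) X = parity (coloured col' i) X.
Proof.
move=> s; rewrite /parity; congr (odd #|pred_of_set _|).
apply/setP => x; rewrite !inE; have [xX|//] := boolP (x \in X).
by rewrite agree // (subsetP s).
Qed.

Lemma chain_local i x X : X \subset Z -> chain col i x X -> chain col' i x X.
Proof.
by move=> s h Y YF xY YX; rewrite -parity_local ?h // (subset_trans YX).
Qed.

Lemma represents_local i x X : X \subset Z -> represents col i x X -> represents col' i x X.
Proof.
move=> s [h1 h2 h3 h4]; split=> //; last first.
- move=> Y YF xY YX; rewrite -parity_local ?h4 //.
  exact: subset_trans (proper_sub YX) s.
- by rewrite -parity_local.
- by move: h2; rewrite !inE agree // (subsetP s).
Qed.

End Local.

Lemma coded_local col col' Z X : (forall x, x \in Z -> col x = col' x) ->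
  X \subset Z -> coded col X -> coded col' X.
Proof.
move=> e s [i [x [h u]]]; exists i, x; split; first exact: (represents_local e s h).
by move=> i' x' h'; apply: u; apply: (@represents_local col' col Z) => // y /e.
Qed.

Lemma end_local col col' i Z b x : (forall x, x \in Z -> col x = col' x) ->
  end_of col i Z b x -> end_of col' i Z b x.
Proof.
move=> e [h1 h2 h3 h4]; split=> //; first by rewrite -e.
  exact: (chain_local e (subxx _) h3).
by move=> y yZ h; apply: h4 => //; apply: (@chain_local col' col Z) => // z /e.
Qed.

Lemma parity_children (Z : {set V}) A : Z \in F -> 1 < #|Z| ->
  parity A Z = odd (\sum_(C in [set child Z x | x in Z]) parity A C).
Proof.
move=> ZF Z1; rewrite /parity.
have -> : #|Z :&: A| = \sum_(C in [set child Z x | x in Z]) #|C :&: A|.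
  rewrite -sum1_card (partition_big (child Z) (mem [set child Z x | x in Z])) /=; last first.
    by move=> x /setIP [xZ _]; apply: imset_f.
  apply: eq_bigr => C /imsetP [x xZ ->]; rewrite -sum1_card; apply: eq_bigl => y.
  rewrite !inE; have [c1 c2 c3 c4] := childP ZF Z1 xZ.
  apply/andP/andP => [[/andP [yZ yA] /eqP <-]|[yC yA]].
    by have [] := childP ZF Z1 yZ.
  by rewrite yA (child_eq ZF Z1 xZ yC) eqxx (subsetP (proper_sub c3)).
elim/big_ind2: _ => // [a b c d h1 h2|C _]; first by rewrite !oddD h1 h2.
by rewrite oddb.
Qed.

Lemma parity_two_children Z A x y : Z \in F -> 1 < #|Z| -> x \in Z -> y \in Z ->
  child Z x != child Z y ->
  (forall z, z \in Z -> child Z z != child Z x -> child Z z != child Z y ->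
     ~~ parity A (child Z z)) ->
  parity A Z = parity A (child Z x) (+) parity A (child Z y).
Proof.
move=> ZF Z1 xZ yZ xy h; rewrite parity_children //.
rewrite (bigD1 (child Z x)) ?imset_f //= (bigD1 (child Z y)) /=; last first.
  by rewrite imset_f //= eq_sym.
rewrite big1 ?addn0 ?oddD; last first.
  by move=> C /andP [/andP [/imsetP [z zZ ->] h1] h2]; rewrite (negbTE (h z zZ h1 h2)).
by case: parity; case: parity.
Qed.

(** Induction on the size of [Z], with [s] the demand from above. The invariant passed down is that
    each set is asked for at most two classes and keeps a free one for its own path. *)
Lemma realize Z (s : 'I_3 -> option bool) : Z \in F -> Z != set0 -> (exists i, s i = None) ->
  exists col, realizes col Z s.
Proof.
have [n] := ubnP #|Z|; elim: n Z s => // n IH Z s; rewrite ltnS => Zn ZF Z0 [i0 si0].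
have [Z1|Z1] := leqP #|Z| 1.
  have /cards1P [x eZ] : #|Z| == 1 by rewrite eqn_leq Z1 card_gt0.
  (* A leaf meets the whole demand with its single vertex. *)
  subst Z; exists (fun _ => s).
  have p i : parity (coloured (fun=> s) i) [set x] = (s i != None).
    rewrite /parity; have [e|ne] := altP (s i =P None).
      by rewrite (_ : _ :&: _ = set0) ?cards0 //; apply/setP => y; rewrite !inE e eqxx andbF.
    by rewrite (_ : _ :&: _ = [set x]) ?cards1 //; apply/setP => y; rewrite !inE ne andbT.
  split=> //; last by move=> X _ /subset_leq_card; rewrite cards1 leqNgt; case: leqP.
  move=> i b sb; exists x; split; rewrite ?set11 //; last by move=> y /set1P.
  move=> Y _ xY; rewrite subset1 => /orP [/eqP ->|/eqP e]; first by rewrite p sb.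
  by rewrite e inE in xY.
have [x1 [x2 [x1Z x2Z ne]]] := two_children ZF Z1.
set c1 := child Z x1 in ne *; set c2 := child Z x2 in ne *.
have [j ji0] : exists j, j != i0 by exists (lift i0 ord0); rewrite eq_sym neq_lift.
have [k ki0 kj] : exists2 k, k != i0 & k != j.
  have : 0 < #|~: [set i0; j]| by rewrite cardsCs setCK card_ord cards2 eq_sym ji0.
  by case/card_gt0P => k; rewrite !inE negb_or => /andP []; exists k.
(* The free class [i0] joins [c1] to [c2], with the marked end in [c1]. Demand in class [j] goes to
   [c1] and demand in class [k] to [c2], so [k] stays free in [c1], [j] in [c2], and [i0] in all
   other children. *)
pose st (C : {set V}) (i : 'I_3) : option bool :=
  if C == c1 then if i == i0 then Some true else if i == j then s j else None
  else if C == c2 then if i == i0 then Some false else if i == j then None else s i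
  else None.
have st1 i : st c1 i = if i == i0 then Some true else if i == j then s j else None.
  by rewrite /st eqxx.
have st2 i : st c2 i = if i == i0 then Some false else if i == j then None else s i.
  by rewrite /st eqxx eq_sym (negbTE ne).
have st3 C i : C != c1 -> C != c2 -> st C i = None.
  by rewrite /st => /negbTE -> /negbTE ->.
(* Stated for every set [C], with a premise that only children satisfy, so that one colouring per
   set can be chosen at once. *)
have ex (C : {set V}) : exists col, forall x, x \in Z -> C = child Z x -> realizes col C (st C).
  have [/imsetP [x xZ eC]|nC] := boolP (C \in [set child Z x | x in Z]); last first.
    by exists (fun _ _ => None) => x xZ e; rewrite e imset_f in nC.
  have [h1 h2 h3 h4] := childP ZF Z1 xZ.
  have [| | | |col hcol] := IH C (st C); last by exists col.
  - by rewrite eC (leq_trans (proper_card h3)).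
  - by rewrite eC.
  - by rewrite eC; apply/set0Pn; exists x.
  have [->|n1] := eqVneq C c1; first by exists k; rewrite st1 (negbTE ki0) (negbTE kj).
  have [->|n2] := eqVneq C c2; first by exists j; rewrite st2 (negbTE ji0) eqxx.
  by exists i0; rewrite st3.
have [colc hc] := fin_all_exists ex.
pose col x := colc (child Z x) x.
have agree x y : x \in Z -> y \in child Z x -> colc (child Z x) y = col y.
  by move=> xZ yC; rewrite /col (child_eq ZF Z1 xZ yC).
have childZ x : x \in Z -> child Z x \subset Z.
  by move=> xZ; have [_ _ /proper_sub] := childP ZF Z1 xZ.
have xchild x : x \in Z -> x \in child Z x by move=> xZ; have [] := childP ZF Z1 xZ.
have childF x : x \in Z -> child Z x \in F by move=> xZ; have [] := childP ZF Z1 xZ.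
have childM x Y : x \in Z -> Y \in F -> x \in Y -> Y \proper Z -> Y \subset child Z x.
  by move=> xZ YF xY YZ; have [_ _ _ h] := childP ZF Z1 xZ; exact: h.
have pc x i : x \in Z -> parity (coloured col i) (child Z x) = (st (child Z x) i != None).
  move=> xZ; have [h _ _] := hc _ x xZ erefl; rewrite -h; symmetry.
  by apply: (@parity_local _ _ (child Z x)) => // y yC; apply: agree.
have ec x i b : x \in Z -> st (child Z x) i = Some b ->
    exists y, end_of col i (child Z x) b y.
  move=> xZ e; have [_ h _] := hc _ x xZ erefl; have [y hy] := h i b e; exists y.
  by apply: end_local hy => z zC; apply: agree.
(* Class [i0] is odd at both [c1] and [c2] and cancels; any other class is asked of at most one
   child. *)
have pZ i : parity (coloured col i) Z = (s i != None).
  rewrite (parity_two_children ZF Z1 x1Z x2Z ne); last first.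
    by move=> z zZ n1 n2; rewrite pc // st3.
  rewrite !pc // -/c1 -/c2 st1 st2.
  have [->|ni] := eqVneq i i0; first by rewrite si0.
  by have [<-|_] := eqVneq i j; case: (s i).
have chainZ i x : x \in Z -> parity (coloured col i) Z ->
    chain col i x (child Z x) -> chain col i x Z.
  move=> xZ pi h Y YF xY YZ; have [->//|nY] := eqVneq Y Z.
  by apply: h => //; apply: childM => //; rewrite properEneq nY.
have chainC i x : x \in Z -> chain col i x Z -> chain col i x (child Z x).
  by move=> xZ h Y YF xY YC; apply: h => //; apply: subset_trans YC (childZ _ xZ).
have chain_st i x : x \in Z -> chain col i x (child Z x) -> st (child Z x) i != None.
  by move=> xZ h; rewrite -pc //; apply: h; rewrite ?xchild ?childF.
exists col; split=> //.
(* The demand in class [i] went to a single child and all others are even in that class, so the end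
   found there is the only one in [Z]. *)
- move=> i b sb; have ii0 : i != i0 by apply: contraTneq isT => e; rewrite e si0 in sb.
  have [z [zZ ez uz]] : exists z, [/\ z \in Z, st (child Z z) i = Some b &
      forall y, y \in Z -> st (child Z y) i != None -> child Z y = child Z z].
    have [ij|ij] := eqVneq i j; [exists x1 | exists x2]; split=> //; rewrite -/c1 -/c2.
    + by rewrite st1 (negbTE ii0) ij eqxx -ij.
    + move=> y yZ; apply: contraNeq => n1; have [e|n2] := eqVneq (child Z y) c2.
        by rewrite e st2 (negbTE ii0) ij eqxx.
      by rewrite st3.
    + by rewrite st2 (negbTE ii0) (negbTE ij).
    + move=> y yZ; apply: contraNeq => n2; have [e|n1] := eqVneq (child Z y) c1.
        by rewrite e st1 (negbTE ii0) (negbTE ij).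
      by rewrite st3.
  have [x [xC cb xch ux]] := ec z i b zZ ez.
  have xZ := subsetP (childZ _ zZ) _ xC.
  have exz := child_eq ZF Z1 zZ xC.
  exists x; split=> //; first by apply: chainZ => //; [rewrite pZ sb | rewrite exz].
  move=> y yZ hy; have hy' := chainC _ _ yZ hy.
  have eyz := uz y yZ (chain_st _ _ yZ hy').
  by apply: ux; rewrite -eyz // xchild.
move=> X XF XZ X1; have [eX|nX] := eqVneq X Z; last first.
  have /card_gt0P [x xX] := ltnW X1; have xZ := subsetP XZ _ xX.
  have XC : X \subset child Z x by apply: childM => //; rewrite properEneq nX.
  have [_ _ h] := hc _ x xZ erefl.
  by apply: coded_local XC (h X XF XC X1) => y yC; apply: agree.
(* [Z] is named by the marked end of class [i0] in [c1]: that class is odd all the way up to [c1]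
   and even at [Z]. *)
subst X; have [|x [xC cb xch ux]] := ec x1 i0 true x1Z; first by rewrite -/c1 st1 eqxx.
have xZ := subsetP (childZ _ x1Z) _ xC.
have ex1 : child Z x = c1 by rewrite (child_eq ZF Z1 x1Z xC).
exists i0, x; split.
  split=> //; first by rewrite inE cb.
    by rewrite pZ si0.
  move=> Y YF xY YZ; apply: xch => //.
  by rewrite -(child_eq ZF Z1 x1Z xC); apply: childM.
(* Uniqueness: the class must be odd at the child containing [y] but even at [Z], which leaves [i0];
   in [c2] the only candidate carries the unmarked boolean. *)
move=> i y [yZ]; rewrite inE => /eqP yc; rewrite pZ negbK => /eqP si hy.
have ych : chain col i y (child Z y).
  have [_ _ cZ _] := childP ZF Z1 yZ.
  by move=> Y YF yY YC; apply: hy => //; apply: sub_proper_trans YC cZ.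
have ist := chain_st _ _ yZ ych.
have ei : i = i0.
  apply/eqP; apply: contraNT ist => ii0.
  have [->|n1] := eqVneq (child Z y) c1.
    by rewrite st1 (negbTE ii0); have [<-|_] := eqVneq i j; rewrite ?si.
  have [->|n2] := eqVneq (child Z y) c2.
    by rewrite st2 (negbTE ii0); have [_|_] := eqVneq i j; rewrite ?si.
  by rewrite st3.
subst i; split=> //.
have [e1|n1] := eqVneq (child Z y) c1.
  by apply: ux; rewrite -/c1 -e1 ?xchild.
have [e2|n2] := eqVneq (child Z y) c2; last by rewrite st3 in ist.
have [|z [zC zb zch uz]] := ec x2 i0 false x2Z; first by rewrite -/c2 st2 eqxx.
have ez : y = z by apply: uz; rewrite -/c2 -e2 ?xchild.
by rewrite ez zb in yc.
Qed.

End Laminar.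

(** * The tree of strong splits rooted at a vertex *)

Section Rooted.
Variables (V : finType) (E : rel V) (r : V).
Implicit Types X Y Z : {set V}.

Definition rooted := [set X : {set V} | strongb E X & r \notin X].
Local Notation F := rooted.

Lemma rooted_strong X : X \in F -> strongb E X.
Proof. by rewrite inE => /andP []. Qed.

Lemma rooted_root X : X \in F -> r \in X = false.
Proof. by rewrite inE => /andP [_ /negbTE]. Qed.

Lemma rooted_neq0 X : X \in F -> X != set0.
Proof. by move/rooted_strong/strong_neq0. Qed.

(** The root [r] lies in neither set, which excludes the case where they cover [V]. *)
Lemma rooted_laminar X Y : X \in F -> Y \in F ->
  [\/ [disjoint X & Y], X \subset Y | Y \subset X].
Proof.
move=> hX hY; case: (strong_cross (rooted_strong hX) (rooted_strong hY)).
- by constructor 1.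
- by constructor 2.
- by constructor 3.
- by move/setP/(_ r); rewrite !inE !rooted_root.
Qed.

Lemma rooted_set1 x : x != r -> [set x] \in F.
Proof.
move=> xr; rewrite inE strong_set1; first by rewrite !inE eq_sym xr.
by apply/card_gt1P; exists x, r.
Qed.

Lemma rooted_singletons X x : X \in F -> x \in X -> [set x] \in F.
Proof.
by move=> hX hx; apply: rooted_set1; apply: contraTneq hx => ->; rewrite rooted_root.
Qed.

Lemma rooted_top : 1 < #|V| -> ~: [set r] \in F.
Proof. by move=> V1; rewrite inE strongC strong_set1 // !inE eqxx. Qed.

(** [setT] stands for the leaf [r], at which the tree is rooted; any other node is the strong set of
    the leaves below it. *)
Definition is_node X := (X == setT) || (X \in F).
Definition node := {X : {set V} | is_node X}.

Definition parent X : {set V} := [arg min_(Y < setT | is_node Y && (X \proper Y)) #|Y|].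

Lemma rooted_proper X : X \in F -> X \proper setT.
Proof.
by move=> h; rewrite properT; apply: strong_neqT; exact: rooted_strong h.
Qed.

Lemma parentP X : X \in F -> [/\ is_node (parent X), X \proper parent X &
  forall Y, is_node Y -> X \proper Y -> parent X \subset Y].
Proof.
move=> hX; rewrite /parent; case: arg_minnP => [|P /andP [P1 P2] min].
  by rewrite /is_node eqxx rooted_proper.
split=> // Y Y1 Y2; have le : #|P| <= #|Y| by apply: min; rewrite Y1.
case/orP: Y1 => [/eqP ->|Y1]; first exact: subsetT.
case/orP: P1 => [/eqP eP|P1].
  by move: le; rewrite eP leqNgt proper_card ?rooted_proper.
case: (rooted_laminar P1 Y1) => // [d|s].
  have /set0Pn [x hx] := rooted_neq0 hX.
  by have := disjointFr d (subsetP (proper_sub P2) _ hx); rewrite (subsetP (proper_sub Y2)).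
by have /eqP <- : Y == P by rewrite eqEcard s le.
Qed.

Lemma parent_child X x : X \in F -> 1 < #|X| -> x \in X -> parent (child F X x) = X.
Proof.
move=> hX X1 xX; have [h1 h2 h3 h4] := childP rooted_laminar rooted_singletons hX X1 xX.
have [p1 p2 p3] := parentP h1.
have s : parent (child F X x) \subset X by apply: p3 => //; rewrite /is_node hX orbT.
apply/eqP; apply: contraT => ne.
have pp : parent (child F X x) \proper X by rewrite properEneq ne.
have pF : parent (child F X x) \in F.
  case/orP: p1 => // /eqP e; rewrite e in s.
  by move: (rooted_proper hX); rewrite properT eqEsubset s subsetT.
have := h4 _ pF (subsetP (proper_sub p2) _ h2) pp.
by move: p2; rewrite properE => /andP [_ /negP].
Qed.

Definition up (a b : node) := (val a \in F) && (val b == parent (val a)).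
Definition tree_adj : rel node := fun a b => up a b || up b a.
Local Notation adj := tree_adj.

Lemma up_proper a b : up a b -> val a \proper val b.
Proof. by case/andP => h /eqP ->; have [] := parentP h. Qed.

Lemma up_ex (a : node) : val a != setT -> exists b, up a b.
Proof.
case: a => X nX /= hX; have XF : X \in F by move: nX; rewrite /is_node (negbTE hX).
have [p1 _ _] := parentP XF; exists (Sub (parent X) p1).
by rewrite /up /= XF eqxx.
Qed.

Lemma up_fun a b c : up a b -> up a c -> b = c.
Proof. by case/andP => _ /eqP e /andP [_ /eqP e']; apply: val_inj; rewrite e e'. Qed.

Lemma up_min a b (c : node) : up a b -> val a \proper val c -> val b \subset val c.
Proof. by case/andP => h /eqP -> ac; have [_ _ h3] := parentP h; apply: h3 => //; exact: valP. Qed.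

Lemma root_node : is_node setT. Proof. by rewrite /is_node eqxx. Qed.
Definition root : node := Sub setT root_node.

Lemma up_ind (P : node -> Prop) : P root -> (forall a b, up a b -> P b -> P a) -> forall a, P a.
Proof.
move=> P0 PS a; have [n] := ubnP (#|V| - #|val a|); elim: n a => // n IH a; rewrite ltnS => le.
have [e|ne] := eqVneq (val a) setT; first by rewrite (_ : a = root) //; exact: val_inj.
have [b ab] := up_ex ne; apply: (PS a b ab); apply: IH.
have lt := proper_card (up_proper ab).
by apply: leq_trans le; exact: ltn_sub2l (leq_trans lt (max_card _)) lt.
Qed.

Lemma adj_sym : symmetric adj.
Proof. by move=> a b; rewrite /tree_adj orbC. Qed.

Lemma tree_tree : is_tree adj.
Proof.
split.
- exact: adj_sym.
- by move=> a; rewrite /tree_adj orbb; apply/negP => /up_proper; rewrite properxx.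
- have h a : connect adj a root.
    elim/up_ind: a => [|a b ab]; first exact: connect0.
    by apply: connect_trans; apply: connect1; rewrite /tree_adj ab.
  move=> a b; apply: connect_trans (h a) _; rewrite (sym_connect_sym adj_sym); exact: h.
- move=> [c [c3 cu cc]].
  have [a0 a0c] : exists a, a \in c by case: c c3 {cu cc} => // a c _; exists a; rewrite mem_head.
  (* In a cycle, both neighbours of a node of least cardinality would be its parent, hence equal. *)
  have [a ac amin] : exists2 a, a \in c & forall b, b \in c -> #|val a| <= #|val b|.
    by case: (arg_minnP (fun a : node => #|val a|) a0c) => a h1 h2; exists a.
  case: (rot_to ac) => i s e; move: cc; rewrite -(rot_cycle i) e.
  move: cu; rewrite -(rot_uniq i) e; move: c3; rewrite -(size_rot i) e.
  have up_of b : b \in a :: s -> adj a b -> up a b.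
    rewrite -e mem_rot => bc /orP [//|/up_proper/proper_card].
    by rewrite ltnNge amin.
  case: s e up_of => [//|b [//|d s]] e up_of _ /and4P [_ bu _ _] /= /andP [ab].
  case/andP => _; rewrite rcons_path => /andP [_].
  rewrite adj_sym => /up_of h; move: bu.
  have ab' : up a b by apply: up_of; rewrite // !inE eqxx orbT.
  rewrite (up_fun ab' (h _)) ?mem_last //.
by rewrite 2!in_cons mem_last !orbT.
Qed.

Lemma tree_leaf_node x : is_node (if x == r then setT else [set x]).
Proof. by rewrite /is_node; case: ifPn => [_|/rooted_set1 ->]; rewrite ?eqxx ?orbT. Qed.

Definition tree_leaf x : node := Sub _ (tree_leaf_node x).

Lemma tree_leaf_sub x X : X \in F -> (val (tree_leaf x) \subset X) = (x \in X).
Proof.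
move=> hX /=; case: eqP => [->|_]; last by rewrite sub1set.
by rewrite rooted_root // subTset; apply/negbTE; rewrite -properT rooted_proper.
Qed.

Section Edge.
Variables x p : node.
Hypothesis xp : up x p.

Let e : rel node := fun a b => adj a b && ~~ ((a == x) && (b == p) || (a == p) && (b == x)).

Let e_sym : symmetric e.
Proof.
move=> a b; rewrite /e adj_sym; congr (_ && ~~ _).
by rewrite orbC; congr (_ || _); rewrite andbC.
Qed.

Let p_nsub : ~~ (val p \subset val x).
Proof. by have := up_proper xp; rewrite properE => /andP []. Qed.

(** Only the edge from [x] to [p] leaves the nodes below [x], since a parent is the least node above
    its child. Conversely, climbing from a node below [x] reaches [x]. *)
Lemma comp_below : comp_edge adj x p x = [set y : node | val y \subset val x].
Proof.
apply/setP => y; rewrite !inE; apply/idP/idP.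
  apply: (connect_invariant (P := fun y : node => val y \subset val x)) => // a b ax /andP [ab ne].
  case/orP: ab => [ab|/up_proper/proper_sub s]; last exact: subset_trans s ax.
  have [eax|nax] := eqVneq a x.
    by subst a; move: ne; rewrite (up_fun ab xp) !eqxx.
  apply: up_min ab _; rewrite properEneq ax andbT.
  by apply: contraNneq nax => /val_inj ->.
elim/up_ind: y => [s|a b ab IH s].
  by move: p_nsub; rewrite (subset_trans (subsetT _) s).
have [->|nax] := eqVneq a x; first exact: connect0.
have bx : val b \subset val x.
  apply: up_min ab _; rewrite properEneq s andbT.
  by apply: contraNneq nax => /val_inj ->.
apply: connect_trans (IH bx) _; apply: connect1; rewrite /tree_adj ab orbT (negbTE nax) andbF /=.
by apply: contra p_nsub; rewrite orbF => /andP [_ /eqP <-].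
Qed.

Lemma comp_above : comp_edge adj x p p = [set y : node | ~~ (val y \subset val x)].
Proof.
apply/setP => y; rewrite !inE; apply/idP/idP.
  apply: (connect_invariant (P := fun y : node => ~~ (val y \subset val x))) => //.
  move=> a b ax /andP [ab ne].
  case/orP: ab => [/up_proper/proper_sub s|ba]; first by apply: contra ax; exact: subset_trans.
  apply: contra ax => bx; have [ebx|nbx] := eqVneq b x.
    by subst b; move: ne; rewrite (up_fun ba xp) !eqxx orbT.
  apply: up_min ba _; rewrite properEneq bx andbT.
  by apply: contraNneq nbx => /val_inj ->.
have h (a : node) : ~~ (val a \subset val x) -> connect e a root.
  elim/up_ind: a => [|a b ab IH s]; first by rewrite connect0.
  have s' : ~~ (val b \subset val x).
    by apply: contra s; apply: subset_trans; exact: proper_sub (up_proper ab).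
  apply: connect_trans (IH s'); apply: connect1; rewrite /e /tree_adj ab /=.
  apply/negP => /orP [] /andP [/eqP ea /eqP eb]; subst.
    by rewrite subxx in s.
  by rewrite subxx in s'.
move=> hy; apply: connect_trans (h _ p_nsub) _.
rewrite (sym_connect_sym e_sym); exact: h.
Qed.

Lemma split_below : leaves_of tree_leaf (comp_edge adj x p x) = val x.
Proof.
apply/setP => y; rewrite in_set comp_below in_set tree_leaf_sub //.
by case/andP: xp.
Qed.

Lemma split_above : leaves_of tree_leaf (comp_edge adj x p p) = ~: val x.
Proof.
apply/setP => y; rewrite in_set comp_above in_set in_setC tree_leaf_sub //.
by case/andP: xp.
Qed.

End Edge.

Lemma edge_cases u v : adj u v ->
  (up u v /\ edge_split1 adj tree_leaf u v = val u /\ edge_split2 adj tree_leaf u v = ~: val u) \/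
  (up v u /\ edge_split1 adj tree_leaf u v = ~: val v /\ edge_split2 adj tree_leaf u v = val v).
Proof.
rewrite /edge_split1 /edge_split2 => /orP [h|h]; [left|right].
  by rewrite split_below ?split_above.
by rewrite (comp_edge_swap _ u v u) (comp_edge_swap _ u v v) split_below // split_above.
Qed.

Lemma up_rooted a b : up a b -> val a \in F.
Proof. by case/andP. Qed.

(** The set [~: [set r]] contains all members of [F], so no other set can be a child of the root. *)
Lemma deg_root : deg adj root <= 1.
Proof.
rewrite /deg leqNgt; apply/card_gt1P => -[a [b []]]; rewrite !inE.
have h c : adj root c -> val c = ~: [set r].
  case/orP => [/up_rooted/rooted_proper|cr]; first by rewrite properxx.
  have cF := up_rooted cr.
  have V1 : 1 < #|V|.
    have [[x hx] nr] : (exists x, x \in val c) /\ r \notin val c.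
      by split; [apply/set0Pn; exact: rooted_neq0|rewrite rooted_root].
    by apply/card_gt1P; exists x, r; split=> //; apply: contraNneq nr => <-.
  have s : val c \subset ~: [set r] by rewrite subsetC sub1set inE rooted_root.
  apply/eqP; apply: contraT => ne.
  have top := rooted_top V1.
  have nt : is_node (~: [set r]) by rewrite /is_node top orbT.
  have := up_min (c := Sub _ nt) cr; rewrite /= properEneq ne s => /(_ isT).
  by move=> /subsetP/(_ r); rewrite !inE eqxx => /(_ isT).
by move=> /h ea /h eb; rewrite -(inj_eq val_inj) ea eb eqxx.
Qed.

Lemma deg_singleton (z : node) x : val z = [set x] -> val z \in F -> deg adj z <= 1.
Proof.
move=> ez zF; rewrite /deg leqNgt; apply/card_gt1P => -[a [b []]]; rewrite !inE.
have h c : adj z c -> up z c.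
  case/orP => // cz; have := rooted_neq0 (up_rooted cz).
  by have := proper_card (up_proper cz); rewrite ez cards1 ltnS leqn0 cards_eq0 => ->.
by move=> /h ha /h hb; rewrite (up_fun ha hb) eqxx.
Qed.

Lemma deg_inner (z : node) : val z \in F -> 1 < #|val z| -> 3 <= deg adj z.
Proof.
move=> zF z1; have [x [y [hx hy ne]]] := two_children rooted_laminar rooted_singletons zF z1.
have zT : val z != setT by rewrite -properT rooted_proper.
have [p zp] := up_ex zT.
have ch t : t \in val z -> exists c : node, val c = child F (val z) t /\ up c z.
  move=> ht; have [h1 _ _ _] := childP rooted_laminar rooted_singletons zF z1 ht.
  have nc : is_node (child F (val z) t) by rewrite /is_node h1 orbT.
  by exists (Sub _ nc); rewrite /up /= h1 parent_child // eqxx.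
have [a [ea az]] := ch x hx; have [b [eb bz]] := ch y hy.
have ab : a != b by rewrite -(inj_eq val_inj) ea eb.
have np c : up c z -> p != c.
  move=> cz; apply/eqP => epc; subst c.
  by have := proper_trans (up_proper cz) (up_proper zp); rewrite properxx.
have <- : #|[set p; a; b]| = 3.
  by rewrite -setUA cardsU1 !inE negb_or !np // cards2 ab.
apply: subset_leq_card; apply/subsetP => t; rewrite !inE /tree_adj.
by case/orP => [/orP []|] /eqP ->; rewrite ?zp ?az ?bz ?orbT.
Qed.

Lemma node_cases (z : node) :
  z = root \/ (exists2 x, x != r & val z = [set x]) \/ (val z \in F /\ 1 < #|val z|).
Proof.
case: (orP (valP z)) => [/eqP e|zF]; first by left; apply: val_inj.
right; have [z1|z1] := leqP #|val z| 1; last by right.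
have /cards1P [x ex] : #|val z| == 1 by rewrite eqn_leq z1 card_gt0 rooted_neq0.
left; exists x => //; apply: contraFneq (rooted_root zF) => <-.
by rewrite ex set11.
Qed.

Lemma inner_codom (z : node) : val z \in F -> 1 < #|val z| -> z \notin codom tree_leaf.
Proof.
move=> zF z1; apply/negP => /codomP [x ez]; move: zF z1; rewrite ez /=.
by case: eqP => _; [move/rooted_proper; rewrite properxx | rewrite cards1].
Qed.

Lemma root_codom : root \in codom tree_leaf.
Proof. by apply/codomP; exists r; apply: val_inj; rewrite /= eqxx. Qed.

Lemma set1_codom (z : node) x : x != r -> val z = [set x] -> z \in codom tree_leaf.
Proof. by move=> xr ez; apply/codomP; exists x; apply: val_inj; rewrite /= (negbTE xr). Qed.

(** Provides a split tree for every graph with a vertex. Each edge points up in one direction and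
    its split consists of its lower end and the complement; every strong split has exactly one side
    avoiding [r]. *)
Lemma rooted_split_tree : split_tree E adj tree_leaf.
Proof.
split; split.
- exact: tree_tree.
- move=> x y /(congr1 val) /=; case: eqP => [->|xr]; case: eqP => [->|yr] //.
  + by move/setP/(_ r); rewrite !inE; case: eqP => // /esym.
  + by move/setP/(_ r); rewrite !inE; case: eqP => // /esym.
  + by move/set1_inj.
- move=> z; case: (node_cases z) => [->|[[x xr ez]|[zF z1]]].
  + by rewrite deg_root root_codom.
  + by rewrite (deg_singleton ez) ?ez ?rooted_set1 // (set1_codom xr ez).
  + by rewrite (negbTE (inner_codom zF z1)) leqNgt (leq_trans _ (deg_inner zF z1)).
- move=> z; case: (node_cases z) => [->|[[x xr ez]|[zF z1]]] h.
  + by rewrite root_codom in h.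
  + by rewrite (set1_codom xr ez) in h.
  + exact: deg_inner.
- move=> u v /edge_cases [[h [-> ->]]|[h [-> ->]]]; last apply: strong_split_sym;
    by apply/strongbP; exact: rooted_strong (up_rooted h).
(* Neither set contains [r], so they cannot be complementary. *)
- have key X Y : X \in F -> Y \in F -> (X = Y \/ X = ~: Y \/ ~: X = Y) -> X = Y.
    move=> hX hY [//|[e|e]]; exfalso; move/setP/(_ r): e; by rewrite !inE !rooted_root.
  have key2 u v u' v' : up u v -> up u' v' ->
      (val u = val u' \/ val u = ~: val u' \/ ~: val u = val u') -> u = u' /\ v = v'.
    move=> uv uv' e; have eu : u = u'.
      by apply: val_inj; apply: key e; [exact: up_rooted uv | exact: up_rooted uv'].
    by subst u'; rewrite (up_fun uv uv').
  move=> u v u' v' /edge_cases [[h [-> ->]]|[h [-> ->]]]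
    /edge_cases [[h' [-> ->]]|[h' [-> ->]]] /upair_eqP e; apply/upair_eqP;
    case: (key2 _ _ _ _ h h').
  + by case: e => -[e1 e2]; auto.
  + by left.
  + by case: e => -[e1 e2]; auto.
  + by right.
  + by case: e => -[e1 e2]; auto.
  + by right.
  + by case: e => -[e1 e2]; auto.
  + by left.
- have key X : X \in F -> exists u v, [/\ adj u v,
      edge_split1 adj tree_leaf u v = X & edge_split2 adj tree_leaf u v = ~: X].
    move=> hX; have nX : is_node X by rewrite /is_node hX orbT.
    have [v uv] := @up_ex (Sub X nX) (etrans (esym (properT _)) (rooted_proper hX)).
    exists (Sub X nX), v.
    by rewrite /edge_split1 /edge_split2 split_below // split_above // /tree_adj uv.
  move=> X Y sXY; have eY : Y = ~: X by case: sXY => /is_splitC.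
  subst Y; move/strongbP: sXY => sX; have [rX|rX] := boolP (r \in X).
    have [|u [v [uv e1 e2]]] := key (~: X); first by rewrite inE strongC sX inE rX.
    by exists u, v; split=> //; rewrite e1 e2 setCK; apply/upair_eqP; right.
  have [|u [v [uv e1 e2]]] := key X; first by rewrite inE sX.
  by exists u, v; split=> //; rewrite e1 e2; apply/upair_eqP; left.
Qed.

End Rooted.

(** * The transduction *)

(* The code [(None, d)] at [x] names the singleton of [x], [(Some i, d)] the larger
   set marked by [x] in class [i]; [d = false] stands for the complement. *)
Definition code := (option 'I_3 * bool)%type.
(* [None] is the root, [Some (i, false)] the ends of the paths of class [i] and
   [Some (i, true)] the marked ends. *)
Definition param := option ('I_3 * bool).

Section Denotation.
Variables (V : finType) (E : rel V) (P : param -> {set V}).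
Implicit Types X Y S : {set V}.

Definition rootedb X := strongb E X && [forall z, (z \in P None) ==> (z \notin X)].

Definition encodes (o : option 'I_3) x X := match o with
  | None => (x \notin P None) && (X == [set x])
  | Some i => [&& rootedb X, x \in X, x \in P (Some (i, true)), ~~ (X == [set x]),
      ~~ odd #|X :&: P (Some (i, false))| &
      [forall Y : {set V}, [&& rootedb Y, x \in Y, Y \subset X & ~~ (Y == X)] ==>
         odd #|Y :&: P (Some (i, false))|]]
  end.

Definition denotes (c : code) x S := strongb E S &&
  [exists X : {set V}, (if c.2 then X == S else X == ~: S) && encodes c.1 x X].

(** The codes name the strong sets bijectively. This is tested on the guessed sets by a filter, so
    correctness never asks whether they come from a colouring of the intended kind. *)
Definition good := [&&
  [forall c, forall x, forall S : {set V}, forall S' : {set V},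
     denotes c x S && denotes c x S' ==> (S == S')],
  [forall c, forall c', forall x, forall x', forall S : {set V},
     denotes c x S && denotes c' x' S ==> (c == c') && (x == x')] &
  [forall S : {set V}, strongb E S ==> [exists c, exists x, denotes c x S]]].

Definition denoted c x := [exists S : {set V}, denotes c x S].

Definition denoted_rel q c c' x x' := [exists S : {set V}, exists S' : {set V},
  [&& denotes c x S, denotes c' x' S' &
   match q with TEdge => S' == ~: S | CEdge => cedgeb E S S' end]].

End Denotation.

(** * Definability of the codes *)

Lemma def_const n m b : @definable n m (fun V E v W => b).
Proof.
case: b; last exact: def_false.
by apply: (@def_ext _ _ (fun V E v W => ~~ false)) => //; apply: def_not; exact: def_false.
Qed.

Ltac def_auto := cbv beta; repeat first
  [ apply: def_all1; cbv beta | apply: def_all2; cbv beta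
  | apply: def_ex1; cbv beta | apply: def_ex2; cbv beta
  | apply: def_not | apply: def_imp | apply: def_and | apply: def_iff
  | apply: def_mem | apply: def_edge | apply: def_subset | apply: def_eqset ].

Lemma def_splitb n m j :
  @definable n m (fun V E v W => splitb E (W j)).
Proof. rewrite /splitb. def_auto. Qed.

Lemma def_overlapb n m i j :
  @definable n m (fun V E v W => overlapb (W i) (W j)).
Proof. rewrite /overlapb. def_auto. Qed.

Lemma def_strongb n m j :
  @definable n m (fun V E v W => strongb E (W j)).
Proof.
rewrite /strongb; apply: def_and; first exact: def_splitb.
apply: def_all2; apply: def_imp; first exact: def_splitb.
by apply: def_not; exact: def_overlapb.
Qed.

Lemma def_cedgeb n m i j :
  @definable n m (fun V E v W => cedgeb E (W i) (W j)).
Proof.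
apply: def_and; first by def_auto.
apply: def_and; first by def_auto.
apply: def_and; last by def_auto.
apply: def_all2; cbv beta; apply: def_imp.
  by apply: def_and; [exact: def_strongb | def_auto].
by apply: def_or; [apply: def_eqset | apply: def_eqsetC].
Qed.

(** Parameters are free set variables, and entering a set quantifier raises their indices by one. *)
Definition shift_var m (w : param -> 'I_m) : param -> 'I_m.+1 :=
  fun q => lift ord0 (w q).

Lemma def_rootedb n m (w : param -> 'I_m) j :
  @definable n m (fun V E v W =>
    rootedb E (fun q => W (w q)) (W j)).
Proof. by apply: def_and; [exact: def_strongb | def_auto]. Qed.

Lemma def_encodes n m (w : param -> 'I_m) o i j :
  @definable n m (fun V E v W =>
    encodes E (fun q => W (w q)) o (v i) (W j)).
Proof.
case: o => [k|] /=; last by def_auto; exact: def_eqset1.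
apply: def_and; first exact: def_rootedb.
do 2!(apply: def_and; first exact: def_mem).
apply: def_and; first by apply: def_not; exact: def_eqset1.
apply: def_and; first by apply: def_not; exact: def_oddI.
apply: def_all2; cbv beta; apply: def_imp; last exact: def_oddI.
apply: def_and; first exact: (def_rootedb n (shift_var w)).
def_auto.
Qed.

Lemma def_denotes n m (w : param -> 'I_m) c i j :
  @definable n m (fun V E v W =>
    denotes E (fun q => W (w q)) c (v i) (W j)).
Proof.
rewrite /denotes; apply: def_and; first exact: def_strongb.
apply: def_ex2; cbv beta; apply: def_and; last exact: (def_encodes (shift_var w)).
by case: c => o [] /=; [apply: def_eqset | apply: def_eqsetC].
Qed.

Definition pvar (q : param) : 'I_#|{: param}| := enum_rank q.

Lemma def_good : @definable 0 #|{: param}| (fun V E v W =>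
  good E (fun q => W (pvar q))).
Proof.
apply: def_and.
  apply: def_allK => c; apply: def_all1; do 2!(apply: def_all2); cbv beta.
  apply: def_imp; last exact: def_eqset.
  by apply: def_and; apply: (def_denotes (shift_var (shift_var pvar))).
apply: def_and.
  apply: def_allK => c; apply: def_allK => c'; do 2!apply: def_all1; apply: def_all2; cbv beta.
  apply: def_imp; last by apply: def_and; [exact: def_const | exact: def_eqv].
  by apply: def_and; apply: (def_denotes (shift_var pvar)).
apply: def_all2; apply: def_imp; first exact: def_strongb.
apply: def_exK => c; apply: def_ex1; cbv beta.
exact: (def_denotes (shift_var pvar)).
Qed.

Lemma def_denoted c : @definable 1 #|{: param}| (fun V E v W =>
  denoted E (fun q => W (pvar q)) c (v ord0)).
Proof. by apply: def_ex2; apply: (def_denotes (shift_var pvar)). Qed.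

Lemma def_denoted_rel q c c' : @definable 2 #|{: param}| (fun V E v W =>
  denoted_rel E (fun q => W (pvar q)) q c c' (v ord0) (v ord_max)).
Proof.
do 2!apply: def_ex2; cbv beta.
apply: def_and; first exact: (def_denotes (shift_var (shift_var pvar))).
apply: def_and; first exact: (def_denotes (shift_var (shift_var pvar))).
by case: q; [exact: def_eqsetC | exact: def_cedgeb].
Qed.

Lemma iso_trans s (A B C : struct s) : iso A B -> iso B C -> iso A C.
Proof.
move=> [f [bf rf sf]] [g [bg rg sg]]; exists (g \o f); split.
- exact: bij_comp.
- move=> q t; rewrite rf rg; congr rint; apply: eq_from_tnth => i.
  by rewrite !tnth_map.
- move=> p Ts; rewrite sf sg; congr sint; apply: eq_from_tnth => i.
  by rewrite !tnth_map imset_comp.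
Qed.

(** * Good parameters obtained from a colouring *)

Section Good.
Variables (V : finType) (E : rel V) (r : V) (col : colouring V).
Local Notation F := (rooted E r).
Hypothesis col_codes : forall X, X \in F -> 1 < #|X| -> coded F col X.

Definition param_sets (q : param) : {set V} := match q with
  | None => [set r]
  | Some (i, false) => coloured col i
  | Some (i, true) => marked col i end.

Local Notation P := param_sets.

Lemma rootedbE X : rootedb E P X = (X \in F).
Proof.
rewrite /rootedb inE; congr (_ && _); apply/forallP/idP => [/(_ r)|h z].
  by rewrite set11.
by apply/implyP => /set1P ->.
Qed.

Lemma encodesP i x X :
  encodes E P (Some i) x X <-> [/\ X \in F, X != [set x] & represents F col i x X].
Proof.
rewrite /= rootedbE; split.
  case/and5P => XF xX xm nX /andP [np /forallP h]; split=> //; split=> //.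
  move=> Y YF xY YX; apply: (implyP (h Y)); rewrite rootedbE YF xY /=.
  by move: YX; rewrite properEneq andbC.
case=> XF nX [xX xm np h]; apply/and5P; split=> //; apply/andP; split=> //.
apply/forallP => Y; apply/implyP => /and4P []; rewrite rootedbE => YF xY YX nY.
by apply: h => //; rewrite properEneq nY.
Qed.

Lemma encodes_rooted o x X : encodes E P o x X -> X \in F.
Proof.
case: o => [i /encodesP [] //|/andP [/=]]; rewrite inE => xr /eqP ->.
exact: rooted_set1.
Qed.

(** Two sets named by the same class code share [x], so they are nested; were they distinct, the
    smaller one would be odd as well as even. *)
Lemma encodes_fun o x X X' : encodes E P o x X -> encodes E P o x X' -> X = X'.
Proof.
case: o => [i|]; last by move=> /andP [_ /eqP ->] /andP [_ /eqP ->].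
move=> /encodesP [XF _ [xX _ nX hX]] /encodesP [XF' _ [xX' _ nX' hX']].
case: (rooted_laminar XF XF') => [d|s|s].
- by rewrite (disjointFr d xX) in xX'.
- by apply/eqP; apply: contraNT nX => ne; apply: hX' => //; rewrite properEneq ne.
- by apply/esym/eqP; apply: contraNT nX' => ne; apply: hX => //; rewrite properEneq ne.
Qed.

(** A class code names a set with at least two elements, where the uniqueness clause of [coded]
    applies; the other codes name singletons. *)
Lemma encodes_inj o o' x x' X : encodes E P o x X -> encodes E P o' x' X -> o = o' /\ x = x'.
Proof.
have mixed i y y' : encodes E P (Some i) y X -> encodes E P None y' X -> False.
  move=> /encodesP [_ nX [yX _ _ _]] /andP [_ /eqP e].
  by move: nX yX; rewrite e => h /set1P e'; rewrite e' eqxx in h.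
case: o o' => [i|] [i'|] h h'.
- have XF := encodes_rooted h.
  have X1 : 1 < #|X|.
    move: h => /encodesP [_ nX [xX _ _ _]]; rewrite ltnNge; apply: contra nX => X1.
    by rewrite eq_sym eqEcard sub1set xX cards1.
  have [j [y [_ u]]] := col_codes XF X1.
  move: h h' => /encodesP [_ _ /u [-> ->]] /encodesP [_ _ /u [-> ->]].
  by [].
- by case: (mixed _ _ _ h h').
- by case: (mixed _ _ _ h' h).
- move: h h' => /andP [_ /eqP ->] /andP [_ /eqP e]; split=> //; exact: set1_inj.
Qed.

Lemma denotesP c x S : denotes E P c x S <->
  exists X, S = (if c.2 then X else ~: X) /\ encodes E P c.1 x X.
Proof.
split=> [/andP [_ /existsP [X /andP [h e]]]|[X [-> e]]].
  exists X; split=> //; move: h; case: c.2 => /eqP -> //; by rewrite setCK.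
apply/andP; split.
  have := rooted_strong (encodes_rooted e); case: c.2 => //; by rewrite strongC.
by apply/existsP; exists X; rewrite e andbT; case: c.2; rewrite ?setCK.
Qed.

Lemma good_colouring : good E P.
Proof.
apply/and3P; split.
- apply/forallP => c; apply/forallP => x; apply/forallP => S; apply/forallP => S'.
  apply/implyP => /andP [/denotesP [X [-> e]] /denotesP [X' [-> e']]].
  by rewrite (encodes_fun e e').
- apply/forallP => -[o d]; apply/forallP => -[o' d']; apply/forallP => x; apply/forallP => x'.
  apply/forallP => S; apply/implyP => /andP [/denotesP [X [eS e]] /denotesP [X' [eS' e']]].
  (* The boolean of a code can be read off from its set, as encoded sets avoid [r]. *)
  have rS : (r \in S) = ~~ d.
    by rewrite eS; case: (d) => /=; rewrite ?inE (rooted_root (encodes_rooted e)).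
  have rS' : (r \in S) = ~~ d'.
    by rewrite eS'; case: (d') => /=; rewrite ?inE (rooted_root (encodes_rooted e')).
  have ed : d = d' by apply: negb_inj; rewrite -rS -rS'.
  subst d'; have eX : X = X'.
    by move: eS; rewrite eS'; case: (d) => /= [//|/(can_inj (@setCK _))].
  subst X'; have [-> ->] := @encodes_inj o o' x x' X e e'.
  by rewrite !eqxx.
apply/forallP => S; apply/implyP => sS.
have [d [X [XF eS]]] : exists d X, X \in F /\ S = if d then X else ~: X.
  have [rS|rS] := boolP (r \in S).
    by exists false, (~: S); rewrite setCK inE strongC sS inE rS.
  by exists true, S; rewrite inE sS.
have [o [x e]] : exists o x, encodes E P o x X.
  have [X1|X1] := leqP #|X| 1; last first.
    have [i [x [h _]]] := col_codes XF X1; exists (Some i), x; apply/encodesP; split=> //.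
    by apply: contraTneq X1 => ->; rewrite cards1.
  have /cards1P [x ex] : #|X| == 1 by rewrite eqn_leq X1 card_gt0 (rooted_neq0 XF).
  exists None, x; rewrite /= ex eqxx andbT inE; apply: contraFneq (rooted_root XF) => <-.
  by rewrite ex set11.
by apply/existsP; exists (o, d); apply/existsP; exists x; apply/denotesP; exists X.
Qed.

End Good.

Lemma good_ex (V : finType) (E : rel V) : 0 < #|V| -> exists P, good E P.
Proof.
case/card_gt0P => r _.
suff [col h] : exists col, forall X, X \in rooted E r -> 1 < #|X| -> coded (rooted E r) col X.
  by exists (param_sets r col); exact: good_colouring.
have [V1|V1] := leqP #|V| 1.
  exists (fun _ _ => None) => X _ X1.
  by have := leq_trans X1 (leq_trans (max_card _) V1).
(* All members of [F] lie in [~: [set r]], and no path enters this set from above, so the demand is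
   [None] in all three classes. *)
have top := rooted_top E r V1.
have [|col [_ _ h]] := realize (@rooted_laminar _ E r) (@rooted_singletons _ E r)
  (s := fun _ => None) top (rooted_neq0 top); first by exists ord0.
by exists col => X XF X1; apply: h => //; rewrite subsetC sub1set inE (rooted_root XF).
Qed.

Definition code_forms (x : code_rel code) : form graph_voc (code_ar x) #|{: param}| :=
  match x return form graph_voc (code_ar x) #|{: param}| with
  | inl c => sval (def_denoted c)
  | inr (q, c, c') => sval (def_denoted_rel q c c')
  end.

Lemma code_formsE (V : finType) (E : rel V) (W : 'I_#|{: param}| -> {set V}) :
  let P q := W (pvar q) in
  @rstruct (code_rel code) (@code_ar code) V
    (fun x t => @sat graph_voc (graph_struct E) _ _ (code_forms x) (tnth t) W) =
  code_struct (denoted E P) (denoted_rel E P).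
Proof.
move=> P; congr rstruct; apply: functional_extensionality_dep => x.
apply: functional_extensionality_dep => t.
case: x t => [c|[[q c] c']] t /=; last by case: (def_denoted_rel _ _ _) => f /= ->.
by case: (def_denoted _) => f /= ->.
Qed.

Lemma decoded_iso (V : finType) (E : rel V) (P : param -> {set V}) B : good E P ->
  tsem (code_trans code) (code_struct (denoted E P) (denoted_rel E P)) B ->
  iso B (strong_struct E).
Proof.
case/and3P => /forallP dfun /forallP dinj /forallP dsurj.
have dstrong c x S : denotes E P c x S -> strongb E S by case/andP.
apply: (@code_trans_iso _ _ _ _ (strong_struct E) (fun c x S => denotes E P c x (val S))).
- move=> c x; split=> [/existsP [S h]|[S h]]; last by apply/existsP; exists (val S).
  by exists (Sub S (dstrong _ _ _ h)).
- move=> q c c' x x'; split.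
    move=> /existsP [S /existsP [S' /and3P [h h' k]]].
    exists (Sub S (dstrong _ _ _ h)), (Sub S' (dstrong _ _ _ h')); split=> //.
  move=> [S [S' [h h' k]]]; apply/existsP; exists (val S); apply/existsP; exists (val S').
  by apply/and3P.
- move=> c x S S' h h'; apply: val_inj; apply/eqP.
  move: (dfun c) => /forallP/(_ x)/forallP/(_ (val S))/forallP/(_ (val S'))/implyP; apply.
  by rewrite h.
- move=> c c' x x' S h h'.
  move: (dinj c) => /forallP/(_ c')/forallP/(_ x)/forallP/(_ x')/forallP/(_ (val S))/implyP.
  by rewrite h h' => /(_ isT)/andP [/eqP -> /eqP ->].
- move=> S; move: (dsurj (val S)) => /implyP/(_ (valP S))/existsP [c /existsP [x h]].
  by exists c, x.
Qed.

Theorem theorem5p9 :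
  exists tau : trans graph_voc decomp_voc,
  forall (V : finType) (E : rel V),
    irreflexive E -> 0 < #|V| -> gconnected E ->
    (exists B, tsem tau (graph_struct E) B) /\
    (forall B, tsem tau (graph_struct E) B ->
       (exists (N : finType) (adj : rel N) (leaf : V -> N),
          split_tree E adj leaf /\ iso B (enriched E adj leaf)) /\
       (forall (N : finType) (adj : rel N) (leaf : V -> N),
          split_tree E adj leaf -> iso B (enriched E adj leaf))).
Proof.
(* Guess the parameters, filter by [good], write the relations on codes, then decode. *)
have [tau htau] := param_interp (sval def_good) code_forms (code_trans code).
exists tau => V E _ V0 _.
have goodE W : @sat graph_voc (graph_struct E) _ _ (sval def_good) (nilval V) W =
    good E (fun q => W (pvar q)).
  by case: def_good => f /= ->.
split.
  have [P hP] := good_ex E V0.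
  pose W (j : 'I_#|{: param}|) := P (enum_val j).
  have eP : (fun q => W (pvar q)) = P.
    by apply: functional_extensionality => q; rewrite /W enum_rankK.
  have [B hB] := code_trans_ex (denoted E P) (denoted_rel E P).
  exists B; apply/htau; exists W; split; first by rewrite goodE eP.
  by rewrite code_formsE eP.
move=> B /htau [W [h1 h2]]; rewrite goodE in h1; rewrite code_formsE in h2.
have iB := decoded_iso h1 h2.
have iE (N : finType) (adj : rel N) (leaf : V -> N) :
    split_tree E adj leaf -> iso B (enriched E adj leaf).
  by move=> st; apply: iso_trans iB (iso_enriched st).
(* The tree may be rooted at any vertex, independently of the guessed parameters, because
   [iso_enriched] holds for every split tree. *)
split=> //; case/card_gt0P: V0 => r _.
exists (node E r), (@tree_adj _ E r), (tree_leaf E r).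
have st := rooted_split_tree E r; split=> //; exact: iE.
Qed.
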